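(* Let $k$ be a finite field, let $r\ge 2$, and let $A$ be a finitely generated metabelian Lie algebra over $k$. Then the following are equivalent: (1) $A\in \mathrm{ucl}(F_r)$; (2) $A$ is a $\Phi_r$-algebra; (3) there exists $s\in\mathbb{N}$ such that $A$ is (isomorphic to) a subalgebra of $F_{r,s}$.
   Context: All Lie algebras are over $k$; products are left-normed, $uvw=(uv)w$. A Lie algebra is metabelian if it satisfies $(x_1x_2)(x_3x_4)=0$. $F_n$ denotes the free metabelian Lie algebra over $k$ of rank $n$ with free base $a_1,\dots,a_n$. The Fitting radical $\mathrm{Fit}(B)$ of a Lie algebra $B$ is the sum of all nilpotent ideals of $B$; one has $\mathrm{Fit}(F_n)=F_n^2$, which is a module over $R_n=k[x_1,\dots,x_n]$ via $u\cdot x_i=ua_i$; write $R=R_r$. In a metabelian Lie algebra, for $u$ in the derived algebra and elements $b_1,\dots,b_n$, $u\cdot f(b_1,\dots,b_n)$ for $f\in k[x_1,\dots,x_n]$ means: a monomial $x_{i_1}\cdots x_{i_t}$ acts by $u\mapsto u b_{i_1}\cdots b_{i_t}$ (left-normed products), extended linearly (constants act as scalars); this same Lie-term expression $y\cdot f(x_1,\dots,x_n)$ is used with variables. Direct module extension: for a torsion-free $R_n$-module $M$, $F_n\oplus M$ is the Lie algebra on the vector space $F_n\oplus M$ in which $F_n$ is a subalgebra, $MM=0$, and for $m\in M$, $u\in F_n$ with $u\equiv \sum\alpha_ia_i \bmod F_n^2$, $mu=-um=m\cdot(\sum_i\alpha_ix_i)$ (so $F_n^2$ acts trivially on $M$).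 $F_{r,s}=F_r\oplus R^s$ with $R^s$ the free $R$-module of rank $s$. $\mathrm{ucl}(F_r)$ is the class of all Lie algebras over $k$ satisfying every universal sentence of the first-order language $L$ of Lie algebras over $k$ (symbols $0,+,-$, the Lie product, and unary scalar multiplication by each $\alpha\in k$) that is true in $F_r$. Formulas of $L$: $\mathrm{Fit}(x)\equiv\forall y\,(xyx=0)$; for $n\le r+1$, $\varphi(x_1,\dots,x_n)\equiv\bigwedge_{(\alpha_1,\dots,\alpha_n)\in k^n\setminus\{0\}}\neg\mathrm{Fit}(\alpha_1x_1+\dots+\alpha_nx_n)$ (a finite conjunction since $k$ is finite). The collection $\Phi_r$ consists of: $\Phi1$: $\forall x_1,x_2,x_3,x_4\ (x_1x_2)(x_3x_4)=0$. $\Phi2$: $\forall x,y\ (xyx=0\wedge xyy=0\to xy=0)$. $\Phi3$: $\forall x,y,z\ (x\ne0\wedge xy=0\wedge xz=0\to yz=0)$. $\Phi4$: $\forall x_1,\dots,x_{r+1}\ \neg\varphi(x_1,\dots,x_{r+1})$. $\Phi5$: for every $n\le r$ and every nonzero $f\in k[x_1,\dots,x_n]$: $\forall z_1,z_2,x_1,\dots,x_n\ \big((z_1z_2)\cdot f(x_1,\dots,x_n)=0\wedge z_1z_2\ne0\to\neg\varphi(x_1,\dots,x_n)\big)$. $\Phi6$: for every $n\le r$ and every nonzero element $l(a_1,\dots,a_n)$ of $F_n$ (written as a Lie polynomial in $a_1,\dots,a_n$): $\forall x_1,\dots,x_n\ (\varphi(x_1,\dots,x_n)\to l(x_1,\dots,x_n)\ne0)$.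 $\Phi7$: for every $n\le r$ and every finite system $S$ of module equations $y_1f_{i1}+\dots+y_lf_{il}=c_i$ ($i=1,\dots,m$; $f_{ij}\in R_n$; $c_i\in\mathrm{Fit}(F_n)$) which has no solution in the localisation $\mathrm{Fit}(F_n)_\Delta=(R_n\setminus\Delta)^{-1}\mathrm{Fit}(F_n)$, $\Delta=(x_1,\dots,x_n)$: $\forall x_1,\dots,x_n\,\forall y_1,\dots,y_l\ \big(\varphi(x_1,\dots,x_n)\wedge\bigwedge_{j=1}^l\bigwedge_{i=1}^n y_jx_iy_j=0\to\bigvee_{i=1}^m h_i\ne0\big)$, where $h_i=y_1\cdot f_{i1}(x_1,\dots,x_n)+\dots+y_l\cdot f_{il}(x_1,\dots,x_n)-c_i(x_1,\dots,x_n)$ and $c_i(x_1,\dots,x_n)$ is obtained from a Lie polynomial representing $c_i$ by replacing each $a_j$ by $x_j$. A $\Phi_r$-algebra is a Lie algebra over $k$ satisfying all formulas of $\Phi_r$. *)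

(* Defs.v *)
From HB Require Import structures.
From mathcomp Require Import all_boot all_order all_algebra.
From mathcomp Require Import multinomials.mpoly.
From Stdlib Require Import ClassicalEpsilon.

Set Implicit Arguments.
Unset Strict Implicit.
Unset Printing Implicit Defensive.

Import GRing.Theory.
Local Open Scope ring_scope.

Record lieAlg (k : fieldType) := LieAlg {
  lie_car :> lmodType k;
  lie_br : lie_car -> lie_car -> lie_car;
  lie_brDl : forall x y z, lie_br (x + y) z = lie_br x z + lie_br y z;
  lie_brZl : forall (c : k) x y, lie_br (c *: x) y = c *: lie_br x y;
  lie_brDr : forall x y z, lie_br x (y + z) = lie_br x y + lie_br x z;
  lie_brZr : forall (c : k) x y, lie_br x (c *: y) = c *: lie_br x y;
  lie_br_alt : forall x, lie_br x x = 0;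
  lie_jacobi : forall x y z,
    lie_br (lie_br x y) z + lie_br (lie_br y z) x + lie_br (lie_br z x) y = 0
}.
Arguments lie_br {k} _ _ _.

Section Lie.
Variable k : fieldType.

Definition metabelian (A : lieAlg k) : Prop :=
  forall x1 x2 x3 x4 : A,
    lie_br A (lie_br A x1 x2) (lie_br A x3 x4) = 0.

Definition lie_hom (A B : lieAlg k) (h : A -> B) : Prop :=
  (forall x y, h (x + y) = h x + h y) /\
  (forall (c : k) x, h (c *: x) = c *: h x) /\
  (forall x y, h (lie_br A x y) = lie_br B (h x) (h y)).

Definition is_free_metabelian (F : lieAlg k) (n : nat) (a : 'I_n -> F) : Prop :=
  metabelian F /\
  forall B : lieAlg k, metabelian B -> forall b : 'I_n -> B,
    (exists h : F -> B, lie_hom h /\ forall i, h (a i) = b i) /\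
    (forall h1 h2 : F -> B, lie_hom h1 -> lie_hom h2 ->
       (forall i, h1 (a i) = b i) -> (forall i, h2 (a i) = b i) ->
       forall x, h1 x = h2 x).

(* the derived algebra B^2 = span of all products (a finite sum of
   products, scalars being absorbed in the products) *)
Definition derived (B : lieAlg k) (u : B) : Prop :=
  exists (m : nat) (xs ys : 'I_m -> B), u = \sum_(i < m) lie_br B (xs i) (ys i).

Inductive lterm (V : Type) : Type :=
  | TVar of V
  | TZero
  | TAdd of lterm V & lterm V
  | TOpp of lterm V
  | TBr of lterm V & lterm V
  | TScale of k & lterm V.

Fixpoint teval (A : lieAlg k) (V : Type) (e : V -> A) (t : lterm V) : A :=
  match t with
  | TVar v => e v
  | TZero => 0
  | TAdd t1 t2 => teval e t1 + teval e t2
  | TOpp t1 => - teval e t1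
  | TBr t1 t2 => lie_br A (teval e t1) (teval e t2)
  | TScale c t1 => c *: teval e t1
  end.

Inductive qform : Type :=
  | FEq of lterm nat & lterm nat
  | FNot of qform
  | FAnd of qform & qform
  | FOr of qform & qform.

Fixpoint fholds (A : lieAlg k) (e : nat -> A) (f : qform) : Prop :=
  match f with
  | FEq t1 t2 => teval e t1 = teval e t2
  | FNot f1 => ~ fholds e f1
  | FAnd f1 f2 => fholds e f1 /\ fholds e f2
  | FOr f1 f2 => fholds e f1 \/ fholds e f2
  end.

Definition usat (A : lieAlg k) (f : qform) : Prop :=
  forall e : nat -> A, fholds e f.

Definition in_ucl (B A : lieAlg k) : Prop :=
  forall f : qform, usat B f -> usat A f.

Definition fin_gen (A : lieAlg k) : Prop :=
  exists (m : nat) (g : 'I_m -> A), forall x : A, exists t : lterm 'I_m, teval g t = x.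

Definition act_mono (A : lieAlg k) (n : nat) (u : A) (b : 'I_n -> A)
    (m : 'X_{1..n}) : A :=
  foldl (fun v i => iter (m i) (fun w => lie_br A w (b i)) v) u (enum 'I_n).

Definition act (A : lieAlg k) (n : nat) (u : A) (b : 'I_n -> A)
    (f : {mpoly k[n]}) : A :=
  \sum_(m <- msupp f) f@_m *: act_mono u b m.

Definition Fit_el (A : lieAlg k) (x : A) : Prop :=
  forall y : A, lie_br A (lie_br A x y) x = 0.

Definition phi (A : lieAlg k) (n : nat) (x : 'I_n -> A) : Prop :=
  forall alpha : 'I_n -> k, (exists i, alpha i != 0) ->
    ~ Fit_el (\sum_(i < n) alpha i *: x i).

(* the module M = Fit(F_n) = F_n^2 over R_n (action u.x_i = u a_i);
   solvability of  sum_j y_j f_ij = c_i  in the localisation M_Delta,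
   Delta = (x_1,...,x_n), written out with a common denominator s:
   y_j = m_j / s, and  (sum_j m_j f_ij)/s = c_i/1  in M_Delta  iff
   some u notin Delta kills  sum_j m_j f_ij - s c_i.
   A polynomial lies outside Delta iff its constant term is nonzero. *)
Definition solvable_loc (F : lieAlg k) (n : nat) (a : 'I_n -> F) (m l : nat)
    (f : 'I_m -> 'I_l -> {mpoly k[n]}) (c : 'I_m -> F) : Prop :=
  exists (s : {mpoly k[n]}) (y : 'I_l -> F),
    s@_0%MM != 0 /\ (forall j, derived (y j)) /\
    forall i, exists u : {mpoly k[n]}, u@_0%MM != 0 /\
      act (\sum_(j < l) act (y j) a (f i j) - act (c i) a s) a u = 0.

Definition Phi_alg (F : nat -> lieAlg k) (a : forall n, 'I_n -> F n) (r : nat)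
    (A : lieAlg k) : Prop :=
  metabelian A /\
  (forall x y : A, lie_br A (lie_br A x y) x = 0 -> lie_br A (lie_br A x y) y = 0 ->
     lie_br A x y = 0) /\
  (forall x y z : A, x != 0 -> lie_br A x y = 0 -> lie_br A x z = 0 ->
     lie_br A y z = 0) /\
  (forall x : 'I_r.+1 -> A, ~ phi x) /\
  (forall n, (0 < n <= r)%N -> forall f : {mpoly k[n]}, f != 0 ->
     forall (z1 z2 : A) (x : 'I_n -> A),
       act (lie_br A z1 z2) x f = 0 -> lie_br A z1 z2 != 0 -> ~ phi x) /\
  (forall n, (0 < n <= r)%N -> forall t : lterm 'I_n, teval (a n) t != 0 ->
     forall x : 'I_n -> A, phi x -> teval x t != 0) /\
  (forall n, (0 < n <= r)%N -> forall (m l : nat)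
       (f : 'I_m -> 'I_l -> {mpoly k[n]}) (c : 'I_m -> lterm 'I_n),
     (forall i, derived (teval (a n) (c i))) ->
     ~ solvable_loc (a n) f (fun i => teval (a n) (c i)) ->
     forall (x : 'I_n -> A) (y : 'I_l -> A),
       phi x -> (forall j i, lie_br A (lie_br A (y j) (x i)) (y j) = 0) ->
       exists i : 'I_m,
         \sum_(j < l) act (y j) x (f i j) - teval x (c i) != 0).

Definition lin_coeff (F : lieAlg k) (n : nat) (a : 'I_n -> F) (u : F) : 'I_n -> k :=
  epsilon (inhabits (fun _ : 'I_n => (0 : k)))
    (fun alpha => derived (u - \sum_(i < n) alpha i *: a i)).

Definition lin_poly (F : lieAlg k) (n : nat) (a : 'I_n -> F) (u : F) : {mpoly k[n]} :=
  \sum_(i < n) lin_coeff a u i *: 'X_i.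

Definition modact (n s : nat) (m : {ffun 'I_s -> {mpoly k[n]}}) (p : {mpoly k[n]})
  : {ffun 'I_s -> {mpoly k[n]}} := [ffun j => m j * p].

(* A is isomorphic to a subalgebra of F_{r,s}: there is an injective
   Lie homomorphism g = (gF, gM) : A -> F_r (+) R^s, where the product in
   F_{r,s} is  (u + m)(v + m') = uv + m.lin(v) - m'.lin(u). *)
Definition embeds_Frs (F : lieAlg k) (r : nat) (a : 'I_r -> F) (s : nat)
    (A : lieAlg k) : Prop :=
  exists (gF : A -> F) (gM : A -> {ffun 'I_s -> {mpoly k[r]}}),
    (forall x y, gF (x + y) = gF x + gF y /\ gM (x + y) = gM x + gM y) /\
    (forall (c : k) x, gF (c *: x) = c *: gF x /\ gM (c *: x) = c *: gM x) /\
    (forall x y, gF (lie_br A x y) = lie_br F (gF x) (gF y) /\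
                 gM (lie_br A x y) =
                   modact (gM x) (lin_poly a (gF y)) - modact (gM y) (lin_poly a (gF x))) /\
    (forall x y, gF x = gF y -> gM x = gM y -> x = y).

End Lie.

(* Main.v *)
(* The free metabelian Lie algebra F_n embeds (Magnus) into the module R_n^n
   with bracket [d, e] = d (bd e) - e (bd d), where bd d = sum_i d_i x_i, and its
   image is the set of d with bd d a linear form: the monomial homotopy of the
   Koszul complex shows that a Lie homomorphism out of this image is determined
   by, and exists for, any choice of values on the standard basis.

   (3) -> (1): sending the basis of R^s to suitable multiples
   [a_1, a_2] x_1^(N j) gives homomorphisms F_(r,s) -> F_r which do not kill any
   of finitely many prescribed nonzero elements.

   (1) -> (2): an instance of a formula of Phi_r that fails in A involves finitely
   many equations and inequations, hence already fails in F_r.  In F_r, if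
   phi(x_1, ..., x_n) holds then the Fox Jacobian of (x_i), pushed to R_n along a
   left inverse of the linear parts, is a matrix J congruent to the identity
   modulo Delta, and multiplying by the adjugate of J solves systems with
   denominator det J.

   (2) -> (3): let x_1, ..., x_n be a basis of A modulo M = Fit(A).  M is finitely
   presented over R_n, so Phi7 gives a module map Pi : M -> Fit(F_n) which is
   multiplication by s on the products x_i x_j, with s = 1 + sum_l p_l x_l.
   Multiplication by s on Fit(F_n) is induced by the endomorphism
   a_i |-> a_i + sum_l [a_i, a_l] p_l, so Pi extends to a homomorphism
   A -> F_n.  The map m |-> s m - Pi m kills the products x_i x_j and is injective
   on ker Pi; composed with an embedding of the torsion-free module M into
   R_n^l it gives the second component of an embedding of A in F_n (+) R_n^l. *)

Require Import Defs.
From HB Require Import structures.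
From mathcomp Require Import all_boot all_order all_algebra.
From mathcomp Require Import multinomials.mpoly.
From Stdlib Require Import ClassicalEpsilon.

Set Implicit Arguments.
Unset Strict Implicit.
Unset Printing Implicit Defensive.

Import GRing.Theory.
Local Open Scope ring_scope.

Local Notation "x ⋆ y" := (lie_br _ x y) (at level 40, left associativity).

(** * Brackets and linear extension from monomials *)

Section Brackets.
Variables (k : fieldType) (A : lieAlg k).
Implicit Types x y z u v w : A.

Lemma br0l x : 0 ⋆ x = 0.
Proof. by rewrite -{1}(scale0r (0 : A)) lie_brZl scale0r. Qed.

Lemma br0r x : x ⋆ 0 = 0.
Proof. by rewrite -{1}(scale0r (0 : A)) lie_brZr scale0r. Qed.

Lemma brNl x y : (- x) ⋆ y = - (x ⋆ y).
Proof. by rewrite -scaleN1r lie_brZl scaleN1r. Qed.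

Lemma brC x y : x ⋆ y = - (y ⋆ x).
Proof.
apply/eqP; rewrite -addr_eq0; apply/eqP.
by have := lie_br_alt (x + y); rewrite lie_brDl !lie_brDr !lie_br_alt add0r addr0.
Qed.

Lemma br_suml (I : Type) (s : seq I) (P : pred I) (G : I -> A) y :
  (\sum_(i <- s | P i) G i) ⋆ y = \sum_(i <- s | P i) (G i ⋆ y).
Proof.
by apply: (big_morph (fun x => x ⋆ y)) => [a b|]; rewrite ?lie_brDl ?br0l.
Qed.

Lemma br_sumr (I : Type) (s : seq I) (P : pred I) (G : I -> A) y :
  y ⋆ (\sum_(i <- s | P i) G i) = \sum_(i <- s | P i) (y ⋆ G i).
Proof.
by apply: (big_morph (fun x => y ⋆ x)) => [a b|]; rewrite ?lie_brDr ?br0r.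
Qed.

Lemma br_jacobi x y z : x ⋆ y ⋆ z = x ⋆ z ⋆ y + x ⋆ (y ⋆ z).
Proof.
have /eqP := lie_jacobi x y z; rewrite -addrA addr_eq0 => /eqP ->.
by rewrite opprD addrC (brC (y ⋆ z)) opprK (brC z x) brNl opprK.
Qed.

Lemma derived_br x y : derived (x ⋆ y).
Proof. by exists 1%N, (fun=> x), (fun=> y); rewrite big_ord1. Qed.

Lemma derived0 : derived (0 : A).
Proof. by rewrite -(br0l 0); apply: derived_br. Qed.

Lemma derivedD x y : derived x -> derived y -> derived (x + y).
Proof.
move=> [m [a [b ->]]] [n [c [d ->]]].
exists (m + n)%N, (fun i => match split i with inl j => a j | inr j => c j end),
  (fun i => match split i with inl j => b j | inr j => d j end).
rewrite big_split_ord /=; congr (_ + _); apply: eq_bigr => i _.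
  by rewrite (unsplitK (inl i)).
by rewrite (unsplitK (inr i)).
Qed.

Lemma derivedZ c x : derived x -> derived (c *: x).
Proof.
move=> [m [a [b ->]]]; exists m, (fun i => c *: a i), b.
by rewrite scaler_sumr; apply: eq_bigr => i _; rewrite lie_brZl.
Qed.

Lemma derived_sum (I : Type) (s : seq I) (P : pred I) (G : I -> A) :
  (forall i, P i -> derived (G i)) -> derived (\sum_(i <- s | P i) G i).
Proof. by move=> H; apply: big_ind => //; [exact: derived0 | exact: derivedD]. Qed.

(** By the Jacobi identity, right multiplications commute on an element annihilating all products,
    so polynomials act on it as on a module. The condition covers both the derived algebra and,
    later, the elements satisfying [Fit_el]. *)
Definition ccder u := forall x y, u ⋆ (x ⋆ y) = 0.

Lemma ccder0 : ccder 0. Proof. by move=> x y; rewrite br0l. Qed.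

Lemma ccderD u v : ccder u -> ccder v -> ccder (u + v).
Proof. by move=> hu hv x y; rewrite lie_brDl hu hv addr0. Qed.

Lemma ccderZ c u : ccder u -> ccder (c *: u).
Proof. by move=> hu x y; rewrite lie_brZl hu scaler0. Qed.

Lemma ccder_br : metabelian A -> forall x y, ccder (x ⋆ y).
Proof. by move=> hA x y z t; apply: hA. Qed.

Lemma ccder_derived : metabelian A -> forall u, derived u -> ccder u.
Proof.
move=> hA u [m [a [b ->]]] x y; rewrite br_suml big1 // => i _; exact: hA.
Qed.

Lemma ccder_comm u x y : ccder u -> u ⋆ x ⋆ y = u ⋆ y ⋆ x.
Proof. by move=> hu; rewrite br_jacobi hu addr0. Qed.

Lemma fit_el0 : Fit_el (0 : A). Proof. by move=> y; rewrite !br0l. Qed.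

End Brackets.

Section Linext.
Variables (k : fieldType) (n : nat) (V : lmodType k).
Implicit Types (G : 'X_{1..n} -> V) (f g : {mpoly k[n]}).

(** The action [act u b] unfolds to [linext (act_mono u b)], so its linearity in the polynomial
    follows by conversion from the lemmas below. *)
Definition linext G f : V := \sum_(m <- msupp f) f@_m *: G m.

(** A longer list only adds zero coefficients; a common list for two supports gives additivity. *)
Lemma linextEw G f (s : seq 'X_{1..n}) : uniq s -> {subset msupp f <= s} ->
  linext G f = \sum_(m <- s) f@_m *: G m.
Proof.
move=> us sub; rewrite [RHS](bigID (mem (msupp f))) /= [X in _ + X]big1 ?addr0.
  rewrite -big_filter; apply: perm_big; apply: uniq_perm => //.
    exact: filter_uniq.
  by move=> m; rewrite mem_filter; case: (boolP (m \in msupp f)) => // /sub ->.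
by move=> m /memN_msupp_eq0 ->; rewrite scale0r.
Qed.

Lemma linextD G f g : linext G (f + g) = linext G f + linext G g.
Proof.
pose s := undup (msupp f ++ msupp g).
have us : uniq s by apply: undup_uniq.
rewrite !(@linextEw _ _ s) //; first 1 last.
- by move=> m hm; rewrite mem_undup mem_cat hm orbT.
- by move=> m hm; rewrite mem_undup mem_cat hm.
- by move=> m /msuppD_le; rewrite mem_undup.
by rewrite -big_split; apply: eq_bigr => m _; rewrite mcoeffD scalerDl.
Qed.

Lemma linextZ G c f : linext G (c *: f) = c *: linext G f.
Proof.
rewrite !(@linextEw _ _ (msupp f)) //; last exact: msuppZ_le.
by rewrite scaler_sumr; apply: eq_bigr => m _; rewrite mcoeffZ scalerA.
Qed.

Lemma linextX G m : linext G 'X_[m] = G m.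
Proof. by rewrite /linext msuppX big_seq1 mcoeffX eqxx scale1r. Qed.

Lemma linext0 G : linext G 0 = 0.
Proof. by have := linextZ G 0 0; rewrite !scale0r. Qed.

Lemma linextN G f : linext G (- f) = - linext G f.
Proof. by rewrite -(scaleN1r f) linextZ scaleN1r. Qed.

Lemma linext_sum G (I : Type) (s : seq I) (P : pred I) (h : I -> {mpoly k[n]}) :
  linext G (\sum_(i <- s | P i) h i) = \sum_(i <- s | P i) linext G (h i).
Proof. by apply: (big_morph (linext G)) => [a b|]; rewrite ?linextD ?linext0. Qed.

Lemma mpoly_lin_eq (P Q : {mpoly k[n]} -> V) :
  (forall c f g, P (c *: f + g) = c *: P f + P g) ->
  (forall c f g, Q (c *: f + g) = c *: Q f + Q g) ->
  (forall m, P 'X_[m] = Q 'X_[m]) -> P =1 Q.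
Proof.
move=> hP hQ h f.
have z (S : {mpoly k[n]} -> V) : (forall c f g, S (c *: f + g) = c *: S f + S g) -> S 0 = 0.
  by move=> hS; have /eqP := hS 1 0 0; rewrite !scale1r addr0 -subr_eq0 opprD addrA subrr sub0r oppr_eq0 => /eqP.
rewrite (mpolyE f); elim: (msupp f) => [|m s IH]; first by rewrite !big_nil !z.
by rewrite !big_cons hP hQ IH h.
Qed.

End Linext.

(** * Polynomials acting on a metabelian Lie algebra *)

Section Action.
Variables (k : fieldType) (A : lieAlg k) (hA : metabelian A) (n : nat) (b : 'I_n -> A).
Implicit Types (u v : A) (f g : {mpoly k[n]}) (m : 'X_{1..n}).

Lemma iter_brD i j u v :
  iter j (fun w => w ⋆ b i) (u + v) =
  iter j (fun w => w ⋆ b i) u + iter j (fun w => w ⋆ b i) v.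
Proof. by elim: j => //= j ->; rewrite lie_brDl. Qed.

Lemma iter_brZ i j c u :
  iter j (fun w => w ⋆ b i) (c *: u) = c *: iter j (fun w => w ⋆ b i) u.
Proof. by elim: j => //= j ->; rewrite lie_brZl. Qed.

Lemma act_monoD u v m : act_mono (u + v) b m = act_mono u b m + act_mono v b m.
Proof.
rewrite /act_mono; elim: (enum 'I_n) u v => //= i s IH u v.
by rewrite iter_brD IH.
Qed.

Lemma act_monoZ c u m : act_mono (c *: u) b m = c *: act_mono u b m.
Proof.
rewrite /act_mono; elim: (enum 'I_n) u => //= i s IH u.
by rewrite iter_brZ IH.
Qed.

Lemma act_mono0 u : act_mono u b 0%MM = u.
Proof.
rewrite /act_mono; elim: (enum 'I_n) => //= i s IH.
by rewrite mnm0E.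
Qed.

Lemma iter_br_ccder i j u : ccder u -> ccder (iter j (fun w => w ⋆ b i) u).
Proof. by move=> hu; case: j => //= j; apply: ccder_br. Qed.

Lemma ccder_act_mono u m : ccder u -> ccder (act_mono u b m).
Proof.
rewrite /act_mono; elim: (enum 'I_n) u => //= i s IH u hu.
by apply/IH/iter_br_ccder.
Qed.

Lemma iter_br_comm i j y u : ccder u ->
  iter j (fun w => w ⋆ b i) (u ⋆ y) = iter j (fun w => w ⋆ b i) u ⋆ y.
Proof.
move=> hu; elim: j => //= j ->; apply: ccder_comm; exact: iter_br_ccder.
Qed.

Lemma act_mono_br y u m : ccder u -> act_mono (u ⋆ y) b m = act_mono u b m ⋆ y.
Proof.
rewrite /act_mono; elim: (enum 'I_n) u => //= i s IH u hu.
by rewrite iter_br_comm // IH //; apply: iter_br_ccder.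
Qed.

(** [act_mono] multiplies in the fixed order of [enum 'I_n]; [ccder u] lets the extra factor [b i]
    move to its place in that order. *)
Lemma act_monoS u i m : ccder u -> act_mono u b (U_(i) + m)%MM = act_mono (u ⋆ b i) b m.
Proof.
move=> hu; rewrite /act_mono.
have : i \in enum 'I_n by rewrite mem_enum.
have := enum_uniq 'I_n.
elim: (enum 'I_n) u hu => //= j s IH u hu /andP[js us]; rewrite in_cons.
have [-> _|ij /= his] := eqVneq i j.
  rewrite mnmDE mnm1E eqxx add1n iterSr.
  have hv : ccder (iter (m j) (fun w => w ⋆ b j) (u ⋆ b j)).
    by apply/iter_br_ccder/ccder_br.
  (* The index [j] does not recur in [s], so the exponents of [m] and of [U_(j) + m] agree on the
     rest of the list. *)
  elim: s js (iter _ _ _) {us IH} => //= l s IH; rewrite in_cons negb_or => /andP[jl js] v.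
  by rewrite mnmDE mnm1E (negbTE jl) add0n IH.
rewrite mnmDE mnm1E (negbTE ij) add0n IH //; last exact: iter_br_ccder.
by rewrite iter_br_comm.
Qed.

Lemma actDl u v f : act (u + v) b f = act u b f + act v b f.
Proof. by rewrite -big_split; apply: eq_bigr => m _; rewrite act_monoD scalerDr. Qed.

Lemma actZl c u f : act (c *: u) b f = c *: act u b f.
Proof.
rewrite scaler_sumr; apply: eq_bigr => m _.
by rewrite act_monoZ !scalerA mulrC.
Qed.

Lemma act0l f : act 0 b f = 0.
Proof. by have := actZl 0 0 f; rewrite !scale0r. Qed.

Lemma actNl u f : act (- u) b f = - act u b f.
Proof. by rewrite -(scaleN1r u) actZl scaleN1r. Qed.

Lemma act_suml (I : Type) (s : seq I) (P : pred I) (G : I -> A) f :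
  act (\sum_(i <- s | P i) G i) b f = \sum_(i <- s | P i) act (G i) b f.
Proof. by apply: (big_morph (fun u => act u b f)) => [x y|]; rewrite ?actDl ?act0l. Qed.

Lemma actDr u f g : act u b (f + g) = act u b f + act u b g.
Proof. exact: linextD. Qed.

Lemma actZr u c f : act u b (c *: f) = c *: act u b f.
Proof. exact: linextZ. Qed.

Lemma act0r u : act u b 0 = 0.
Proof. exact: linext0. Qed.

Lemma actNr u f : act u b (- f) = - act u b f.
Proof. exact: linextN. Qed.

Lemma act_sumr u (I : Type) (s : seq I) (P : pred I) (G : I -> {mpoly k[n]}) :
  act u b (\sum_(i <- s | P i) G i) = \sum_(i <- s | P i) act u b (G i).
Proof. exact: linext_sum. Qed.

Lemma actX u m : act u b 'X_[m] = act_mono u b m.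
Proof. exact: linextX. Qed.

Lemma act1 u : act u b 1 = u.
Proof. by rewrite -mpolyX0 actX act_mono0. Qed.

Lemma actC u c : act u b c%:MP = c *: u.
Proof. by rewrite -[c%:MP]mulr1 mul_mpolyC actZr act1. Qed.

Lemma ccder_act u f : ccder u -> ccder (act u b f).
Proof.
move=> hu; rewrite /act; apply: big_ind => [||m _]; first exact: ccder0.
  exact: ccderD.
exact/ccderZ/ccder_act_mono.
Qed.

Lemma derived_act u f : derived u -> derived (act u b f).
Proof.
move=> hu; apply: derived_sum => m _; apply: derivedZ.
rewrite /act_mono; elim: (enum 'I_n) u hu => //= i s IH u hu; apply: IH.
by case: (m i) => //= j; apply: derived_br.
Qed.

Lemma act_brl y u f : ccder u -> act (u ⋆ y) b f = act u b f ⋆ y.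
Proof.
by move=> hu; rewrite br_suml; apply: eq_bigr => m _; rewrite act_mono_br ?lie_brZl.
Qed.

Lemma actMX u i f : ccder u -> act u b ('X_i * f) = act u b f ⋆ b i.
Proof.
move=> hu; rewrite -act_brl //.
apply: (@mpoly_lin_eq _ _ _ (fun f => act u b ('X_i * f)) (fun f => act (u ⋆ b i) b f)).
- by move=> c g h; rewrite mulrDr -scalerAr actDr actZr.
- by move=> c g h; rewrite actDr actZr.
- by move=> m; rewrite -mpolyXD !actX act_monoS.
Qed.

Lemma actXU u i : ccder u -> act u b 'X_i = u ⋆ b i.
Proof. by move=> hu; rewrite -['X_i]mulr1 actMX // act1. Qed.

Lemma mdegS_exists m : m != 0%MM -> exists i, exists m', m = (U_(i) + m')%MM.
Proof.
move=> m0; have /existsP[i hi] : [exists i, m i != 0%N].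
  apply: contraNT m0; rewrite negb_exists => /forallP h; apply/eqP/mnmP => i.
  by rewrite mnm0E; apply/eqP; rewrite -[_ == _]negbK.
exists i, (m - U_(i))%MM; rewrite addmC submK //.
by rewrite lep1mP.
Qed.

(** Induction on the degree of a monomial of [f]; [actMX] moves one variable across at each step. *)
Lemma actM u f g : ccder u -> act u b (f * g) = act (act u b f) b g.
Proof.
move=> hu.
apply: (@mpoly_lin_eq _ _ _ (fun f => act u b (f * g)) (fun f => act (act u b f) b g)).
- by move=> c p q; rewrite mulrDl -scalerAl actDr actZr.
- by move=> c p q; rewrite actDr actZr actDl actZl.
move=> m; have [d] := ubnP (mdeg m); elim: d m => // d IH m.
have [->|/mdegS_exists[i [m' ->]]] := eqVneq m 0%MM.
  by rewrite mpolyX0 mul1r act1.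
rewrite mdegD mdeg1 add1n ltnS => hm.
by rewrite mpolyXD -mulrA !actMX // act_brl ?IH //; apply: ccder_act.
Qed.

Lemma actAC u f g : ccder u -> act (act u b f) b g = act (act u b g) b f.
Proof. by move=> hu; rewrite -!actM // mulrC. Qed.

End Action.

(** * Lie terms realising sums and polynomial actions *)

Section Terms.
Variables (k : fieldType) (V : Type).

Definition tsum (I : Type) (s : seq I) (t : I -> lterm k V) : lterm k V :=
  foldr (fun i acc => TAdd (t i) acc) (TZero k V) s.

Definition tact n (u : lterm k V) (b : 'I_n -> lterm k V) (f : {mpoly k[n]}) :=
  tsum (msupp f) (fun m => TScale f@_m
    (foldl (fun v i => iter (m i) (fun w => TBr w (b i)) v) u (enum 'I_n))).

Variables (A : lieAlg k) (e : V -> A).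

Lemma teval_sum (I : Type) (s : seq I) t :
  teval e (tsum s t) = \sum_(i <- s) teval e (t i).
Proof. by elim: s => [|i s IH] /=; rewrite ?big_nil // big_cons IH. Qed.

Lemma teval_act n (u : lterm k V) (b : 'I_n -> lterm k V) f :
  teval e (tact u b f) = act (teval e u) (fun i => teval e (b i)) f.
Proof.
rewrite teval_sum; apply: eq_bigr => m _ /=; congr (_ *: _); rewrite /act_mono.
elim: (enum 'I_n) u => //= i s IH u; rewrite IH; congr foldl.
by elim: (m i) => //= j ->.
Qed.

Fixpoint tmap (W : Type) (g : V -> W) (t : lterm k V) : lterm k W :=
  match t with
  | TVar v => TVar _ (g v)
  | TZero => TZero _ _
  | TAdd t1 t2 => TAdd (tmap g t1) (tmap g t2)
  | TOpp t1 => TOpp (tmap g t1)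
  | TBr t1 t2 => TBr (tmap g t1) (tmap g t2)
  | TScale c t1 => TScale c (tmap g t1)
  end.

End Terms.

Lemma teval_map (k : fieldType) (V W : Type) (A : lieAlg k) (g : V -> W) (e : W -> A) t :
  teval e (tmap g t) = teval (fun v => e (g v)) t.
Proof. by elim: t => //= [t1 -> t2 ->|t ->|t1 -> t2 ->|c t ->]. Qed.

Lemma teval_ext (k : fieldType) (V : Type) (A : lieAlg k) (e1 e2 : V -> A) t :
  e1 =1 e2 -> teval e1 t = teval e2 t.
Proof. by move=> h; elim: t => //= [t1 -> t2 ->|t ->|t1 -> t2 ->|c t ->]. Qed.

(** * The Koszul complex *)

Section Koszul.
Variables (k : fieldType) (n : nat).
Local Notation R := {mpoly k[n]}.
Local Notation W := {ffun 'I_n -> {mpoly k[n]}}.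
Implicit Types (d e : W) (f g : R) (m : 'X_{1..n}) (i j l : 'I_n).

(** The Koszul differential from $R^n$ to $R$. On Fox derivatives it gives the class of an element
    modulo the derived algebra, as a linear form. *)
Definition bd d : R := \sum_i d i * 'X_i.

Definition eps i f : W := [ffun l => (l == i)%:R * f].

(** Up to sign, the Koszul boundary of $f\,e_i\wedge e_j$. *)
Definition kos i j f : W := eps i ('X_j * f) - eps j ('X_i * f).

Lemma bdD d e : bd (d + e) = bd d + bd e.
Proof. by rewrite -big_split; apply: eq_bigr => i _; rewrite ffunE mulrDl. Qed.

Lemma bdZ c d : bd (c *: d) = c *: bd d.
Proof. by rewrite scaler_sumr; apply: eq_bigr => i _; rewrite ffunE scalerAl. Qed.

Lemma bd0 : bd 0 = 0.
Proof. by have := bdZ 0 0; rewrite !scale0r. Qed.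

Lemma bdN d : bd (- d) = - bd d.
Proof. by rewrite -(scaleN1r d) bdZ scaleN1r. Qed.

Lemma bd_sum (I : Type) (s : seq I) (P : pred I) (G : I -> W) :
  bd (\sum_(i <- s | P i) G i) = \sum_(i <- s | P i) bd (G i).
Proof. by apply: (big_morph bd) => [x y|]; rewrite ?bdD ?bd0. Qed.

Lemma bd_modact d f : bd (modact d f) = bd d * f.
Proof. by rewrite mulr_suml; apply: eq_bigr => i _; rewrite ffunE mulrAC. Qed.

Lemma sum_deltal (V : pzRingType) (G : 'I_n -> V) i : \sum_l (l == i)%:R * G l = G i.
Proof.
rewrite (bigD1 i) //= eqxx mul1r big1 ?addr0 // => l /negbTE ->; exact: mul0r.
Qed.

Lemma bd_eps i f : bd (eps i f) = f * 'X_i.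
Proof.
rewrite /bd; under eq_bigr do rewrite ffunE -mulrA.
by rewrite (sum_deltal (fun l => f * 'X_l)).
Qed.

Lemma bd_kos i j f : bd (kos i j f) = 0.
Proof. by rewrite bdD bdN !bd_eps (mulrC 'X_j f) (mulrC 'X_i f) mulrAC subrr. Qed.

Lemma epsD i f g : eps i (f + g) = eps i f + eps i g.
Proof. by apply/ffunP => l; rewrite !ffunE mulrDr. Qed.

Lemma epsZ i c f : eps i (c *: f) = c *: eps i f.
Proof. by apply/ffunP => l; rewrite !ffunE scalerAr. Qed.

Lemma sum_eps d : d = \sum_i eps i (d i).
Proof.
apply/ffunP => l; rewrite sum_ffunE.
under eq_bigr do rewrite ffunE eq_sym.
by rewrite (sum_deltal (fun i => d i)).
Qed.

Lemma modact_kos i j f g : modact (kos i j f) g = kos i j (f * g).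
Proof. by apply/ffunP => l; rewrite !ffunE mulrBl !mulrA. Qed.

Lemma kosZ i j c f : kos i j (c *: f) = c *: kos i j f.
Proof. by rewrite /kos -!scalerAr !epsZ scalerBr. Qed.

Lemma kosC i j f : kos i j f = - kos j i f.
Proof. by rewrite /kos opprB. Qed.

Lemma kosii i f : kos i i f = 0.
Proof. exact: subrr. Qed.

(* The first variable dividing the monomial. *)
Definition lead m : option 'I_n :=
  [pick j | (m j != 0%N) && [forall l : 'I_n, (l < j)%N ==> (m l == 0%N)]].

Lemma lead_eq m j : m j != 0%N -> (forall l, (l < j)%N -> m l = 0%N) -> lead m = Some j.
Proof.
move=> mj hj; rewrite /lead; case: pickP => [j' /andP[mj' /forallP hj']|/(_ j)].
  congr Some; apply/val_inj/eqP; rewrite eqn_leq; apply/andP; split.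
    by rewrite leqNgt; apply/negP => lt; have := hj' j; rewrite lt (negbTE mj).
  by rewrite leqNgt; apply/negP => /hj; apply/eqP.
rewrite mj /= => /negP[]; apply/forallP => l; apply/implyP => /hj ->; exact: eqxx.
Qed.

Lemma lead_some m j : lead m = Some j -> m j != 0%N /\ forall l, (l < j)%N -> m l = 0%N.
Proof.
rewrite /lead; case: pickP => // j' /andP[mj' /forallP hj'] [<-]; split=> // l hl.
by apply/eqP; have := hj' l; rewrite hl.
Qed.

Lemma lead0 : lead 0%MM = None.
Proof. by rewrite /lead; case: pickP => // j; rewrite mnm0E. Qed.

Lemma lead_none m : lead m = None -> m = 0%MM.
Proof.
move=> hm; apply/mnmP => i; rewrite mnm0E; apply/eqP/negPn/negP => mi.
have [j mj hj] := @arg_minnP _ i (fun j => m j != 0%N) (fun j : 'I_n => nat_of_ord j) mi.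
rewrite (@lead_eq m j) // in hm => l hl; apply/eqP/negPn/negP => ml.
by have := hj l ml; rewrite leqNgt hl.
Qed.

Lemma leadU i m : lead (U_(i) + m)%MM =
  Some (if lead m is Some l then if (l < i)%N then l else i else i).
Proof.
case hm: (lead m) => [l|]; last first.
  rewrite (lead_none hm) addm0; apply: lead_eq => [|l hl]; rewrite mnm1E ?eqxx //.
  by case: eqP hl => // ->; rewrite ltnn.
have [ml hl] := lead_some hm; case: ltnP => h; apply: lead_eq => [|p hp]; rewrite mnmDE mnm1E.
- by rewrite addn_eq0 negb_and ml orbT.
- rewrite hl // addn0; case: eqP hp => // <- hp.
  by have := ltn_trans hp h; rewrite ltnn.
- by rewrite eqxx.
- rewrite hl ?(leq_trans hp) // addn0; case: eqP hp => // ->; by rewrite ltnn.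
Qed.

Lemma addU_subl m i l : m l != 0%N -> (U_(i) + m - U_(l) = U_(i) + (m - U_(l)))%MM.
Proof. by move=> ml; rewrite addmBA // lep1mP. Qed.

Lemma addU_sub m l : m l != 0%N -> (U_(l) + (m - U_(l)) = m)%MM.
Proof. by move=> ml; rewrite addmC submK // lep1mP. Qed.

(** The homotopy from degree one to degree two, followed by the boundary, at the vector $X^m
    e_i$. *)
Definition kosk i m : W :=
  if lead m is Some j then if (j < i)%N then kos i j 'X_[m - U_(j)] else 0 else 0.

Definition division m : W := if lead m is Some j then eps j 'X_[m - U_(j)] else 0.

(* [linext division] and [kosk] form a contracting homotopy of the Koszul
   complex in degree one, so cycles are boundaries. *)
Lemma koszul_homotopy d :
  \sum_i linext (kosk i) (d i) = d - linext division (bd d).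
Proof.
have H i f : linext (kosk i) f = eps i f - linext division ('X_i * f).
  move: f; apply: mpoly_lin_eq => [c f g|c f g|m].
  - by rewrite linextD linextZ.
  - by rewrite mulrDr -scalerAr linextD linextZ epsD epsZ opprD addrACA -scalerBr.
  rewrite -mpolyXD !linextX /kosk /division leadU.
  case hm: (lead m) => [l|]; last by rewrite (lead_none hm) addmC addmK subrr.
  have [ml _] := lead_some hm.
  case: ltnP => h; last by rewrite addmC addmK subrr.
  by rewrite addU_subl // mpolyXD /kos -mpolyXD addU_sub.
rewrite /bd linext_sum {2}(sum_eps d) -sumrB; apply: eq_bigr => i _.
by rewrite H [d i * _]mulrC.
Qed.

(** Exactness in degree one as an induction principle: on a cycle the homotopy formula loses its
    [division] term and leaves a linear combination of Koszul boundaries. *)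
Lemma syz_ind (Q : W -> Prop) :
  Q 0 -> (forall d e, Q d -> Q e -> Q (d + e)) -> (forall c d, Q d -> Q (c *: d)) ->
  (forall i j f, Q (kos i j f)) -> forall d, bd d = 0 -> Q d.
Proof.
move=> q0 qD qZ qk d hd.
have -> : d = \sum_i linext (kosk i) (d i) by rewrite koszul_homotopy hd linext0 subr0.
apply: big_ind => // i _; apply: big_ind => // m _; apply: qZ.
by rewrite /kosk; case: lead => // j; case: ifP.
Qed.

(** The monomial $x_i$ in $\sum_j d_j x_j$ can only come from the constant term of $d_i$. Hence
    cycles have no constant terms. *)
Lemma mcoeffU_bd d i : (bd d)@_U_(i) = (d i)@_0%MM.
Proof.
rewrite /bd raddf_sum /= (bigD1 i) //= big1 ?addr0.
  by rewrite -[X in _@_X]addm0 mcoeffMX.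
move=> j ji; rewrite mulrC mcoeffM; apply: big1 => -[m1 m2] /= /eqP e.
rewrite mcoeffX; case: eqP => [E|]; last by rewrite mul0r.
have /mnmP/(_ j) := e; rewrite -E mnmDE !mnm1E eqxx eq_sym (negbTE ji).
by case: (val m2 j).
Qed.

Lemma syz_coeff0 d i : bd d = 0 -> (d i)@_0%MM = 0.
Proof. by move=> hd; rewrite -mcoeffU_bd hd mcoeff0. Qed.

Section Lift.
Variables (B : lieAlg k) (hB : metabelian B) (b : 'I_n -> B).

(** The counterpart of [kosk] in [B]: the boundary [kos i j f] is replaced by the product of [b i]
    and [b j], acted on by [f]. *)
Definition kap i m : B :=
  if lead m is Some j then
    if (j < i)%N then act_mono (b i ⋆ b j) b (m - U_(j)) else 0
  else 0.

(** Being defined by monomials on all of $R^n$, this map raises no question of well-definedness. On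
    cycles it is the map from $\mathrm{Fit}(F_n)$ induced by $a_i\mapsto b_i$. *)
Definition hsyz d : B := \sum_i linext (kap i) (d i).

Lemma hsyzD d e : hsyz (d + e) = hsyz d + hsyz e.
Proof. by rewrite -big_split; apply: eq_bigr => i _; rewrite ffunE linextD. Qed.

Lemma hsyzZ c d : hsyz (c *: d) = c *: hsyz d.
Proof. by rewrite scaler_sumr; apply: eq_bigr => i _; rewrite ffunE linextZ. Qed.

Lemma hsyz0 : hsyz 0 = 0.
Proof. by have := hsyzZ 0 0; rewrite !scale0r. Qed.

Lemma hsyzN d : hsyz (- d) = - hsyz d.
Proof. by rewrite -(scaleN1r d) hsyzZ scaleN1r. Qed.

Lemma hsyz_sum (I : Type) (s : seq I) (P : pred I) (G : I -> W) :
  hsyz (\sum_(i <- s | P i) G i) = \sum_(i <- s | P i) hsyz (G i).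
Proof. by apply: (big_morph hsyz) => [x y|]; rewrite ?hsyzD ?hsyz0. Qed.

Lemma hsyz_eps i f : hsyz (eps i f) = linext (kap i) f.
Proof.
rewrite /hsyz (bigD1 i) //= ffunE eqxx mul1r big1 ?addr0 // => j /negbTE ji.
by rewrite ffunE ji mul0r linext0.
Qed.

(** For $j<i$: if the first variable $x_l$ of the monomial has $l<j$, the equality is the Jacobi
    identity for $b_i,b_j,b_l$; otherwise one term of [kos] is sent to zero and the other directly
    to the right-hand side. *)
Lemma hsyz_kos i j f : hsyz (kos i j f) = act (b i ⋆ b j) b f.
Proof.
wlog ji : i j / (j < i)%N.
  move=> H; case: (ltngtP i j) => [ij|/H //|/val_inj ->].
    by rewrite kosC hsyzN H // brC actNl opprK.
  by rewrite kosii hsyz0 lie_br_alt act0l.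
have cc := ccder_br hB.
rewrite /kos hsyzD hsyzN !hsyz_eps; move: f; apply: mpoly_lin_eq => [c f g|c f g|m].
- by rewrite !mulrDr -!scalerAr !linextD !linextZ opprD addrACA -scalerBr.
- by rewrite actDr actZr.
rewrite -!mpolyXD !linextX actX /kap !leadU.
case hm: (lead m) => [l|]; last first.
  by rewrite ji ltnNge (ltnW ji) subr0 addmC addmK.
have [ml _] := lead_some hm.
case: (ltnP l j) => lj; last first.
  rewrite ji addmC addmK; case: (ltnP l i) => li; first by rewrite ltnNge lj subr0.
  by rewrite ltnNge (ltnW ji) subr0.
rewrite (ltn_trans lj ji) lj !addU_subl // !act_monoS //.
rewrite -[in RHS](addU_sub ml) act_monoS // -[LHS]/(_ - _).
have -> : b i ⋆ b j ⋆ b l = b i ⋆ b l ⋆ b j - b j ⋆ b l ⋆ b i.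
  rewrite br_jacobi; congr (_ + _); exact: brC.
by rewrite act_monoD -(scaleN1r (_ ⋆ _ ⋆ _)) act_monoZ scaleN1r.
Qed.

(** On Koszul boundaries this is multiplicativity of the action, and these span the cycles. *)
Lemma hsyz_modact d f : bd d = 0 -> hsyz (modact d f) = act (hsyz d) b f.
Proof.
move=> hd; move: d hd f; apply: syz_ind => [f|d e hd he f|c d hd f|i j g f].
- by rewrite hsyz0 act0l (_ : modact 0 f = 0) ?hsyz0 //; apply/ffunP => i; rewrite !ffunE mul0r.
- rewrite hsyzD actDl -hd -he -hsyzD; congr hsyz.
  by apply/ffunP => i; rewrite !ffunE mulrDl.
- rewrite hsyzZ actZl -hd -hsyzZ; congr hsyz.
  by apply/ffunP => i; rewrite !ffunE scalerAl.
- by rewrite modact_kos !hsyz_kos actM //; apply: ccder_br.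
Qed.

Lemma derived_hsyz d : bd d = 0 -> derived (hsyz d).
Proof.
move: d; apply: syz_ind => [|d e|c d|i j f].
- rewrite hsyz0; exact: derived0.
- rewrite hsyzD; exact: derivedD.
- rewrite hsyzZ; exact: derivedZ.
- rewrite hsyz_kos; apply: derived_act; exact: derived_br.
Qed.

End Lift.
End Koszul.

(** * The Magnus embedding *)

Section MagnusAlgebra.
Variables (k : fieldType) (n : nat).
Local Notation R := {mpoly k[n]}.
Local Notation W := {ffun 'I_n -> {mpoly k[n]}}.
Implicit Types d e : W.

Definition wbr d e : W := modact d (bd e) - modact e (bd d).

Lemma wbrE d e i : wbr d e i = d i * bd e - e i * bd d.
Proof. by rewrite !ffunE. Qed.

Lemma bd_wbr d e : bd (wbr d e) = 0.
Proof. by rewrite bdD bdN !bd_modact mulrC subrr. Qed.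

Lemma wbr_jacobi d e f : wbr (wbr d e) f + wbr (wbr e f) d + wbr (wbr f d) e = 0.
Proof.
apply/ffunP => i; rewrite [LHS]ffunE [X in X + _]ffunE [RHS]ffunE.
do 6! rewrite {1}wbrE; do 3! rewrite {1}bd_wbr; rewrite !mulr0 !subr0 !mulrBl.
rewrite (mulrAC (d i) (bd f)) (mulrAC (e i) (bd d)) (mulrAC (f i) (bd e)).
by rewrite !subrKA subrr.
Qed.

(** By [mcoeffU_bd] the constant terms of [d] are the only possible coefficients of the linear form;
    writing them out makes the condition visibly linear in [d]. *)
Definition linform d := bd d == \sum_i (d i)@_0%MM *: 'X_i.

Definition linformb : {pred W} := linform.

Fact linform_closed : submod_closed linformb.
Proof.
split; first by rewrite unfold_in /linform bd0 big1 // => i _; rewrite ffunE mcoeff0 scale0r.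
move=> c d e; rewrite !unfold_in /linform => /eqP hd /eqP he; apply/eqP.
rewrite bdD bdZ hd he scaler_sumr -big_split; apply: eq_bigr => i _ /=.
by rewrite !ffunE mcoeffD mcoeffZ scalerDl scalerA.
Qed.

HB.instance Definition _ := GRing.isSubmodClosed.Build k W linformb linform_closed.

Record magnus := Magnus { mgval : W; _ : mgval \in linformb }.
HB.instance Definition _ := [isSub for mgval].
HB.instance Definition _ := [Choice of magnus by <:].
HB.instance Definition _ := [SubChoice_isSubLmodule of magnus by <:].

Lemma syz_linform d : bd d = 0 -> d \in linformb.
Proof.
move=> hd; rewrite unfold_in /linform hd big1 // => i _.
by rewrite syz_coeff0 // scale0r.
Qed.

Definition mbr (x y : magnus) : magnus :=
  Magnus (syz_linform (bd_wbr (mgval x) (mgval y))).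

Lemma mgvalD x y : mgval (x + y) = mgval x + mgval y. Proof. by []. Qed.
Lemma mgvalN x : mgval (- x) = - mgval x. Proof. by []. Qed.
Lemma mgvalZ c x : mgval (c *: x) = c *: mgval x. Proof. by []. Qed.

Lemma mgval_inj : injective mgval. Proof. exact: val_inj. Qed.

Lemma mbrDl x y z : mbr (x + y) z = mbr x z + mbr y z.
Proof.
apply: mgval_inj; rewrite mgvalD /=; apply/ffunP => i.
by rewrite !ffunE bdD mulrDl mulrDr opprD addrACA.
Qed.

Lemma mbrZl (c : k) x y : mbr (c *: x) y = c *: mbr x y.
Proof.
apply: mgval_inj; rewrite mgvalZ /=; apply/ffunP => i.
by rewrite !ffunE bdZ -scalerAl -scalerAr -scalerBr.
Qed.

Lemma mbrC x y : mbr x y = - mbr y x.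
Proof.
by apply: mgval_inj; rewrite mgvalN /=; apply/ffunP => i; rewrite !ffunE opprB.
Qed.

Lemma mbrDr x y z : mbr x (y + z) = mbr x y + mbr x z.
Proof. by rewrite mbrC mbrDl opprD -!mbrC. Qed.

Lemma mbrZr (c : k) x y : mbr x (c *: y) = c *: mbr x y.
Proof. by rewrite mbrC mbrZl -scalerN -mbrC. Qed.

Lemma mbr_alt x : mbr x x = 0.
Proof. by apply: mgval_inj; apply/ffunP => i; rewrite !ffunE subrr. Qed.

Lemma mbr_jacobi x y z : mbr (mbr x y) z + mbr (mbr y z) x + mbr (mbr z x) y = 0.
Proof. apply: mgval_inj; exact: wbr_jacobi. Qed.

Definition magnus_lie : lieAlg k :=
  LieAlg mbrDl mbrZl mbrDr mbrZr mbr_alt mbr_jacobi.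

Lemma magnus_metabelian : metabelian magnus_lie.
Proof.
move=> x y z t; apply: mgval_inj; apply/ffunP => i.
by rewrite [LHS]wbrE !bd_wbr !mulr0 subrr ffunE.
Qed.

Lemma eps_linform i : eps i 1 \in linformb.
Proof.
rewrite unfold_in /linform bd_eps mul1r; apply/eqP.
rewrite (bigD1 i) //= ffunE eqxx mul1r mcoeff1 eqxx scale1r big1 ?addr0 //.
by move=> j /negbTE ji; rewrite ffunE ji mul0r mcoeff0 scale0r.
Qed.

Section Lift.
Variables (B : lieAlg k) (hB : metabelian B) (b : 'I_n -> B).

(** [hsyz] can be applied to [d] itself instead of its cycle part, because it vanishes on the basis
    vectors [eps i 1]. *)
Definition hmag d : B := \sum_i (d i)@_0%MM *: b i + hsyz b d.

Lemma hmagD d e : hmag (d + e) = hmag d + hmag e.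
Proof.
rewrite /hmag hsyzD addrACA; congr (_ + _); rewrite -big_split; apply: eq_bigr => i _.
by rewrite ffunE mcoeffD scalerDl.
Qed.

Lemma hmagZ c d : hmag (c *: d) = c *: hmag d.
Proof.
rewrite /hmag hsyzZ scalerDr; congr (_ + _); rewrite scaler_sumr; apply: eq_bigr => i _.
by rewrite ffunE mcoeffZ scalerA.
Qed.

Lemma hmag_syz d : bd d = 0 -> hmag d = hsyz b d.
Proof.
by move=> hd; rewrite /hmag big1 ?add0r // => i _; rewrite syz_coeff0 // scale0r.
Qed.

Lemma kap_mono0 i : kap b i 0%MM = 0.
Proof. by rewrite /kap lead0. Qed.

Lemma hsyz_eps1 i : hsyz b (eps i 1) = 0.
Proof. by rewrite hsyz_eps -mpolyX0 linextX kap_mono0. Qed.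

Lemma hmag_eps i : hmag (eps i 1) = b i.
Proof.
rewrite /hmag hsyz_eps1 addr0 (bigD1 i) //= ffunE eqxx mul1r mcoeff1 eqxx scale1r.
rewrite big1 ?addr0 // => j /negbTE ji; by rewrite ffunE ji mul0r mcoeff0 scale0r.
Qed.

Definition linpart d : W := \sum_i (d i)@_0%MM *: eps i 1.

Lemma bd_linpart d : d \in linformb -> bd (d - linpart d) = 0.
Proof.
move=> /eqP hd; rewrite bdD bdN hd bd_sum; apply/eqP; rewrite subr_eq0; apply/eqP.
by apply: eq_bigr => i _; rewrite bdZ bd_eps mul1r.
Qed.

(** Each argument is a linear part plus a cycle. Linear parts give the products of the [b i], mixed
    terms give the polynomial action, and two cycles contribute zero on both sides. *)
Lemma hmag_wbr d e : d \in linformb -> e \in linformb ->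
  hmag (wbr d e) = hmag d ⋆ hmag e.
Proof.
move=> hd he; rewrite hmag_syz ?bd_wbr //.
pose s := d - linpart d; pose t := e - linpart e.
have hs : bd s = 0 by apply: bd_linpart.
have ht : bd t = 0 by apply: bd_linpart.
pose al i := (d i)@_0%MM; pose be i := (e i)@_0%MM.
have ds : d = \sum_i al i *: eps i 1 + s by rewrite addrC subrK.
have et : e = \sum_i be i *: eps i 1 + t by rewrite addrC subrK.
have bdd : bd d = \sum_i al i *: 'X_i by apply/eqP.
have bde : bd e = \sum_i be i *: 'X_i by apply/eqP.
have Es : hsyz b d = hsyz b s.
  rewrite {1}ds hsyzD hsyz_sum big1 ?add0r // => i _.
  by rewrite hsyzZ hsyz_eps1 scaler0.
have Et : hsyz b e = hsyz b t.
  rewrite {1}et hsyzD hsyz_sum big1 ?add0r // => i _.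
  by rewrite hsyzZ hsyz_eps1 scaler0.
have -> : wbr d e = \sum_i \sum_j (al i * be j) *: kos i j 1
    + (modact s (bd e) - modact t (bd d)).
  apply/ffunP => l; rewrite !ffunE.
  rewrite {1}ds {2}et !ffunE !mulrDl opprD addrACA; congr (_ + _).
  rewrite bde bdd !sum_ffunE !mulr_suml.
  under eq_bigr => i _ do rewrite mulr_sumr.
  under [X in _ - X]eq_bigr => i _ do rewrite mulr_sumr.
  rewrite [X in _ - X]exchange_big -sumrB; apply: eq_bigr => i _.
  rewrite sum_ffunE -sumrB; apply: eq_bigr => j _.
  rewrite !ffunE !mulr1 -!scalerAl -!scalerAr !scalerA (mulrC (be j)) scalerBr.
  by [].
have cs := ccder_derived hB (derived_hsyz hB b hs).
have ct := ccder_derived hB (derived_hsyz hB b ht).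
rewrite !hsyzD hsyzN !hsyz_modact // /hmag Es Et.
rewrite lie_brDl !lie_brDr -!addrA; congr (_ + _).
  rewrite hsyz_sum br_suml; apply: eq_bigr => i _.
  rewrite hsyz_sum br_sumr; apply: eq_bigr => j _.
  by rewrite hsyzZ hsyz_kos // act1 lie_brZl lie_brZr scalerA.
have X (u : B) (c : 'I_n -> k) : ccder u ->
    act u b (\sum_i c i *: 'X_i) = u ⋆ (\sum_i c i *: b i).
  move=> hu; rewrite act_sumr br_sumr; apply: eq_bigr => i _.
  by rewrite actZr actXU // lie_brZr.
rewrite bde bdd !X // addrC -brC; congr (_ + _).
(* The term left over is a product of two elements of the derived algebra of [B]. *)
rewrite -[LHS]addr0; congr (_ + _).
have [m [xs [ys ->]]] := derived_hsyz hB b ht.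
by rewrite br_sumr big1 // => i _; rewrite cs.
Qed.

End Lift.
End MagnusAlgebra.

Section FoxAction.
Variables (k : fieldType) (n : nat) (F : lieAlg k) (mu : F -> {ffun 'I_n -> {mpoly k[n]}}).
Hypothesis muP : forall c x y, mu (c *: x + y) = c *: mu x + mu y.
Hypothesis muB : forall x y, mu (x ⋆ y) = wbr (mu x) (mu y).

(** Bracketing a cycle with [b i] multiplies it by [bd (mu (b i))]. Only two equations on [mu] are
    assumed, so that the lemma already serves while the embedding is being constructed. *)
Lemma fox_act p (u : F) (b : 'I_p -> F) f : bd (mu u) = 0 ->
  mu (act u b f) = modact (mu u) (mmap (@mpolyC n k) (fun i => bd (mu (b i))) f).
Proof.
move=> hu; move: f; apply: mpoly_lin_eq => [c f g|c f g|m].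
- by rewrite actDr actZr muP.
- apply/ffunP => l; rewrite !ffunE mmapD mmapZ mulrDr; congr (_ + _).
  by rewrite mul_mpolyC scalerAr.
rewrite actX mmapX /act_mono /mmap1 -big_enum /=.
elim: (enum 'I_p) u hu => [|i s IH] u hu /=.
  by rewrite big_nil; apply/ffunP => l; rewrite ffunE mulr1.
have step j : mu (iter j (fun w => w ⋆ b i) u) = modact (mu u) (bd (mu (b i)) ^+ j).
  elim: j => [|j /= IHj]; first by apply/ffunP => l; rewrite ffunE expr0 mulr1.
  apply/ffunP => l; rewrite muB IHj !ffunE bd_modact hu mul0r mulr0 subr0.
  by rewrite exprSr mulrA.
rewrite IH step; last by rewrite bd_modact hu mul0r.
by apply/ffunP => l; rewrite big_cons !ffunE mulrA.
Qed.

End FoxAction.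

(* [mu x] is the vector of Fox derivatives of [x]: the Magnus embedding, with
   its image and the preimage of the kernel of the augmentation [bd]. *)
Record fox_derivation (k : fieldType) (n : nat) (F : lieAlg k) (a : 'I_n -> F)
    (mu : F -> {ffun 'I_n -> {mpoly k[n]}}) : Prop := FoxDerivation {
  foxP : forall c x y, mu (c *: x + y) = c *: mu x + mu y;
  foxB : forall x y, mu (x ⋆ y) = wbr (mu x) (mu y);
  fox_gen : forall i, mu (a i) = eps i 1;
  fox_inj : injective mu;
  fox_linform : forall x, mu x \in @linformb k n;
  fox_surj : forall d, d \in @linformb k n -> exists x, mu x = d;
  fox_bd0 : forall x, bd (mu x) = 0 -> derived x
}.

Section Magnus.
Variables (k : fieldType) (n : nat) (F : lieAlg k) (a : 'I_n -> F).
Hypothesis hF : is_free_metabelian a.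

Lemma magnus_embedding :
  exists mu : F -> {ffun 'I_n -> {mpoly k[n]}}, fox_derivation a mu.
Proof.
have [mF univ] := hF.
pose e i : magnus_lie k n := Magnus (eps_linform k i).
have [[h [[hD [hZ hB]] he]] _] := univ _ (@magnus_metabelian k n) e.
have [_ uniqF] := univ _ mF a.
pose g (x : magnus_lie k n) : F := hmag a (mgval x).
have ghom : lie_hom g.
  split; first by move=> x y; rewrite /g mgvalD hmagD.
  split; first by move=> c x; rewrite /g mgvalZ hmagZ.
  by move=> x y; rewrite /g /= hmag_wbr //; [case: x | case: y].
(* Uniqueness in the universal property: both sides are endomorphisms of [F] fixing the base. *)
have gh x : g (h x) = x.
  have [gD [gZ gB]] := ghom.
  apply: (uniqF (fun x => g (h x)) id) => //.
  - by split; [|split] => *; rewrite ?hD ?hZ ?hB ?gD ?gZ ?gB.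
  - by move=> i; rewrite he /g hmag_eps.
pose mu (x : F) := mgval (h x).
have muP c x y : mu (c *: x + y) = c *: mu x + mu y by rewrite /mu hD hZ.
have muB x y : mu (x ⋆ y) = wbr (mu x) (mu y) by rewrite /mu hB.
have mua i : mu (a i) = eps i 1 by rewrite /mu he.
have mu0 : mu 0 = 0 by have := muP (-1) 0 0; rewrite scaler0 addr0 scaleN1r addNr.
have muD x y : mu (x + y) = mu x + mu y by rewrite -(scale1r x) muP !scale1r.
have muZ c x : mu (c *: x) = c *: mu x by rewrite -[c *: x]addr0 muP mu0 addr0.
have muS I (s : seq I) (G : I -> F) : mu (\sum_(i <- s) G i) = \sum_(i <- s) mu (G i).
  exact: (big_morph mu muD mu0).
have hK i m : mu (kap a i m) = kosk k i m.
  rewrite /kap /kosk; case: lead => // j; case: ifP => // _.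
  have bk : bd (mu (a i ⋆ a j)) = 0 by rewrite muB bd_wbr.
  rewrite -actX (fox_act muP muB) // muB !mua; apply/ffunP => l.
  rewrite (_ : mmap _ _ _ = 'X_[m - U_(j)]); last first.
    by rewrite mmapX mpolyXE_id; apply: eq_bigr => p _; rewrite mua bd_eps mul1r.
  by rewrite !ffunE !bd_eps !mul1r !mulr1 mulrBl !mulrA.
(* Since [mu] turns [kap] into [kosk], the homotopy formula returns [d]; its [division] term is the
   linear part. *)
have hg d : d \in @linformb k n -> mu (hmag a d) = d.
  move=> /eqP hd; rewrite muD !muS.
  have -> : \sum_i mu ((d i)@_0%MM *: a i) = linpart d.
    by apply: eq_bigr => i _; rewrite muZ mua.
  have -> : \sum_i mu (linext (kap a i) (d i)) = \sum_i linext (kosk k i) (d i).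
    by apply: eq_bigr => i _; rewrite muS; apply: eq_bigr => m _; rewrite muZ hK.
  rewrite koszul_homotopy hd linext_sum addrC.
  rewrite (_ : \sum_i _ = linpart d) ?subrK //; apply: eq_bigr => i _.
  by rewrite linextZ linextX /division -[U_(i)%MM]addm0 leadU lead0 addmC addmK mpolyX0.
exists mu; split=> //.
- by move=> x y hxy; rewrite -(gh x) -(gh y) (val_inj hxy).
- by move=> x; rewrite /mu; case: (h x).
- by move=> d hd; exists (hmag a d); apply: hg.
- by move=> x hx; rewrite -(gh x) /g hmag_syz //; apply: derived_hsyz.
Qed.

End Magnus.

(** * Discrimination of F_(r,s) by F_r *)

Section LieHom.
Variables (k : fieldType) (A B : lieAlg k) (h : A -> B).
Hypothesis hh : lie_hom h.

Lemma lie_hom0 : h 0 = 0.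
Proof. by have [_ [hZ _]] := hh; have := hZ 0 0; rewrite !scale0r. Qed.

Lemma lie_homN x : h (- x) = - h x.
Proof. by have [_ [hZ _]] := hh; rewrite -(scaleN1r x) hZ scaleN1r. Qed.

Lemma lie_homB x y : h (x - y) = h x - h y.
Proof. by have [hD _] := hh; rewrite hD lie_homN. Qed.

Lemma lie_hom_teval (V : Type) (e : V -> A) t : h (teval e t) = teval (h \o e) t.
Proof.
have [hD [hZ hB]] := hh.
elim: t => //= [|t1 <- t2 <-|t <-|t1 <- t2 <-|c t <-] //; first exact: lie_hom0.
exact: lie_homN.
Qed.

Fixpoint atoms (e : nat -> A) (f : qform k) : seq A :=
  match f with
  | FEq t1 t2 => [:: teval e t1 - teval e t2]
  | FNot f1 => atoms e f1
  | FAnd f1 f2 => atoms e f1 ++ atoms e f2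
  | FOr f1 f2 => atoms e f1 ++ atoms e f2
  end.

(** The truth of a quantifier-free formula depends only on which of its atomic differences
    vanish. *)
Lemma fholds_hom (e : nat -> A) f :
  (forall z, z \in atoms e f -> h z = 0 -> z = 0) ->
  fholds (h \o e) f <-> fholds e f.
Proof.
elim: f => /= [t1 t2|f IH|f1 IH1 f2 IH2|f1 IH1 f2 IH2] H.
- rewrite -!lie_hom_teval; split=> [E|-> //].
  apply/eqP; rewrite -subr_eq0; apply/eqP/H; first by rewrite inE.
  by rewrite lie_homB E subrr.
- by have := IH H; tauto.
- have H1 z (hz : z \in atoms e f1) : h z = 0 -> z = 0 by apply: H; rewrite mem_cat hz.
  have H2 z (hz : z \in atoms e f2) : h z = 0 -> z = 0 by apply: H; rewrite mem_cat hz orbT.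
  by have := IH1 H1; have := IH2 H2; tauto.
- have H1 z (hz : z \in atoms e f1) : h z = 0 -> z = 0 by apply: H; rewrite mem_cat hz.
  have H2 z (hz : z \in atoms e f2) : h z = 0 -> z = 0 by apply: H; rewrite mem_cat hz orbT.
  by have := IH1 H1; have := IH2 H2; tauto.
Qed.

End LieHom.

Lemma mmap_mpolyX_id (k : fieldType) n (h : 'I_n -> {mpoly k[n]}) f :
  (forall i, h i = 'X_i) -> mmap (@mpolyC n k) h f = f.
Proof.
move=> hX; move: f; apply: mpoly_lin_eq => [c f g|//|m].
  by rewrite mmapD mmapZ mul_mpolyC.
by rewrite mmapX mpolyXE_id; apply: eq_bigr => i _; rewrite hX.
Qed.

Section FoxTheory.
Variables (k : fieldType) (n : nat) (F : lieAlg k) (a : 'I_n -> F).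
Variable mu : F -> {ffun 'I_n -> {mpoly k[n]}}.
Hypothesis H : fox_derivation a mu.

Lemma fox0 : mu 0 = 0.
Proof. by have := foxP H (-1) 0 0; rewrite scaler0 addr0 scaleN1r addNr. Qed.

Lemma foxD x y : mu (x + y) = mu x + mu y.
Proof. by rewrite -(scale1r x) (foxP H) !scale1r. Qed.

Lemma foxZ c x : mu (c *: x) = c *: mu x.
Proof. by rewrite -[c *: x]addr0 (foxP H) fox0 addr0. Qed.

Lemma foxN x : mu (- x) = - mu x.
Proof. by rewrite -(scaleN1r x) foxZ scaleN1r. Qed.

Lemma fox_sum (I : Type) (s : seq I) (P : pred I) (G : I -> F) :
  mu (\sum_(i <- s | P i) G i) = \sum_(i <- s | P i) mu (G i).
Proof. exact: (big_morph mu foxD fox0). Qed.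

Lemma fox_eq0 x : mu x = 0 -> x = 0.
Proof. by rewrite -fox0 => /(fox_inj H). Qed.

Lemma fox_bdE x : bd (mu x) = \sum_i (mu x i)@_0%MM *: 'X_i.
Proof. by apply/eqP; have := fox_linform H x. Qed.

Lemma fox_derivedP x : derived x <-> bd (mu x) = 0.
Proof.
split; last exact: fox_bd0 H x.
move=> [m [xs [ys ->]]]; rewrite fox_sum bd_sum big1 // => i _.
by rewrite (foxB H) bd_wbr.
Qed.

(** The choice operator in [lin_coeff] is harmless: [bd] of the Fox vector vanishes on derived
    elements, so every admissible choice gives this linear form. *)
Lemma lin_polyE x : lin_poly a x = bd (mu x).
Proof.
have E (al : 'I_n -> k) : bd (mu (x - \sum_i al i *: a i)) =
    bd (mu x) - \sum_i al i *: 'X_i.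
  rewrite foxD foxN bdD bdN fox_sum bd_sum; congr (_ - _); apply: eq_bigr => i _.
  by rewrite foxZ bdZ (fox_gen H) bd_eps mul1r.
have ex : exists al : 'I_n -> k, derived (x - \sum_i al i *: a i).
  by exists (fun i => (mu x i)@_0%MM); apply/fox_derivedP; rewrite E -fox_bdE subrr.
have := epsilon_spec (inhabits (fun _ : 'I_n => (0 : k))) _ ex.
move/fox_derivedP; rewrite E => /eqP; rewrite subr_eq0 => /eqP ->.
by [].
Qed.

Lemma fox_act_derived p (u : F) (b : 'I_p -> F) f : derived u ->
  mu (act u b f) = modact (mu u) (mmap (@mpolyC n k) (fun i => bd (mu (b i))) f).
Proof.
by move/fox_derivedP => hu; apply: (fox_act (foxP H) (foxB H)).
Qed.

Lemma fox_act_gen u f : derived u -> mu (act u a f) = modact (mu u) f.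
Proof.
move=> du; rewrite fox_act_derived // mmap_mpolyX_id // => i.
by rewrite (fox_gen H) bd_eps mul1r.
Qed.

End FoxTheory.

Lemma modact_eq0 (k : fieldType) n s (m : {ffun 'I_s -> {mpoly k[n]}}) p :
  modact m p = 0 -> p != 0 -> m = 0.
Proof.
move=> /ffunP h p0; apply/ffunP => i; have := h i; rewrite !ffunE => /eqP.
by rewrite mulf_eq0 (negbTE p0) orbF => /eqP.
Qed.

(** The powers of one variable are distinct, so they include a non-root even when [k] is finite. *)
Lemma mpoly_nonroot (k : fieldType) n (i : 'I_n) (P : {poly {mpoly k[n]}}) :
  P != 0 -> exists q, P.[q] != 0.
Proof.
move=> P0; pose rs := [seq ('X_i : {mpoly k[n]}) ^+ N | N <- iota 0 (size P)].
have [/allP h|/allPn[q _ hq]] := boolP (all (root P) rs); last by exists q.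
have : uniq rs.
  rewrite map_inj_uniq ?iota_uniq // => p q /(congr1 (fun f => msize f)).
  by rewrite !mpolyXn !msizeX !mdegMn mdeg1 !mul1n => -[].
move/(max_poly_roots P0 _) => /(_ _)/=; rewrite size_map size_iota ltnn.
by move=> /(_ (introT allP h)).
Qed.

Section Discriminate.
Variables (k : fieldType) (r : nat) (F : lieAlg k) (a : 'I_r -> F).
Variable mu : F -> {ffun 'I_r -> {mpoly k[r]}}.
Hypothesis H : fox_derivation a mu.
Variables (tau : {ffun 'I_r -> {mpoly k[r]}}) (i0 : 'I_r).
Hypotheses (bt : bd tau = 0) (tau0 : tau i0 != 0).
Variables (s : nat) (A : lieAlg k) (gF : A -> F) (gM : A -> {ffun 'I_s -> {mpoly k[r]}}).
Hypothesis gD : forall x y, gF (x + y) = gF x + gF y /\ gM (x + y) = gM x + gM y.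
Hypothesis gZ : forall (c : k) x, gF (c *: x) = c *: gF x /\ gM (c *: x) = c *: gM x.
Hypothesis gB : forall x y, gF (x ⋆ y) = gF x ⋆ gF y /\
  gM (x ⋆ y) = modact (gM x) (lin_poly a (gF y)) - modact (gM y) (lin_poly a (gF x)).
Hypothesis gI : forall x y, gF x = gF y -> gM x = gM y -> x = y.

(** The Fox vector of the image of [z] when $F_r$ is fixed and the basis vector of index [j] of
    $R^s$ goes to [tau] times $q^{j+1}$. Exponents start at one, so the $F_r$ component stays alone
    in degree zero in $q$. *)
Definition combine (q : {mpoly k[r]}) (z : A) : {ffun 'I_r -> {mpoly k[r]}} :=
  mu (gF z) + modact tau (\sum_j gM z j * q ^+ j.+1).

Lemma combine_hom q : exists chi : A -> F, lie_hom chi /\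
  forall z, mu (chi z) = combine q z.
Proof.
have lin z : combine q z \in @linformb k r.
  have h1 := fox_linform H (gF z).
  apply: rpredD => //; apply: syz_linform; by rewrite bd_modact bt mul0r.
have ex z : exists x, mu x = combine q z by apply: (fox_surj H).
pose chi z := proj1_sig (constructive_indefinite_description _ (ex z)).
have hchi z : mu (chi z) = combine q z by rewrite /chi; case: constructive_indefinite_description.
exists chi; split=> //; split; [|split].
- move=> x y; apply: (fox_inj H); rewrite (foxD H) !hchi /combine.
  have [-> ->] := gD x y; rewrite (foxD H) addrACA; congr (_ + _).
  apply/ffunP => i; rewrite !ffunE -mulrDr -big_split; congr (_ * _).
  by apply: eq_bigr => j _; rewrite ffunE mulrDl.
- move=> c x; apply: (fox_inj H); rewrite (foxZ H) !hchi /combine.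
  have [-> ->] := gZ c x; rewrite (foxZ H) scalerDr; congr (_ + _).
  apply/ffunP => i; rewrite !ffunE scalerAr; congr (_ * _).
  by rewrite scaler_sumr; apply: eq_bigr => j _; rewrite ffunE scalerAl.
- move=> x y; apply: (fox_inj H); rewrite (foxB H) !hchi.
  have bc z : bd (combine q z) = bd (mu (gF z)).
    by rewrite bdD bd_modact bt mul0r addr0.
  rewrite /wbr !bc /combine; have [-> ->] := gB x y.
  rewrite (foxB H) !(lin_polyE H) /wbr; apply/ffunP => i; rewrite !ffunE.
  rewrite !mulrDl opprD addrACA; congr (_ + _).
  rewrite -!mulrA -mulrBr; congr (_ * _); rewrite !mulr_suml -sumrB.
  by apply: eq_bigr => j _; rewrite !ffunE mulrBl !(mulrAC _ (q ^+ _)).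
Qed.

(** A nonzero [z] is killed only at roots of some nonzero polynomial in $q$; the product of these
    polynomials treats the whole list at once. *)
Lemma combine_nonzero (l : seq A) : exists P : {poly {mpoly k[r]}}, P != 0 /\
  forall q, P.[q] != 0 -> forall z, z \in l -> z != 0 -> combine q z != 0.
Proof.
elim: l => [|z l [P [P0 hP]]]; first by exists 1; rewrite oner_neq0.
have [->|z0] := eqVneq z 0.
  exists P; split=> // q hq y; rewrite in_cons => /orP[/eqP -> /eqP //|]; exact: hP.
(* The value of [Q c] at $q$ is the coordinate [c] of [combine q z], and its coefficients recover
   [gF z] and, through [tau i0], also [gM z]. *)
pose Q c : {poly {mpoly k[r]}} :=
  (mu (gF z) c)%:P + \sum_j (tau c * gM z j)%:P * 'X^(j.+1).
have coefQ c (j : 'I_s) : (Q c)`_j.+1 = tau c * gM z j.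
  rewrite coefD coefC add0r coef_sum (bigD1 j) //= coefCM coefXn eqxx mulr1.
  rewrite big1 ?addr0 // => p /negbTE pj; rewrite coefCM coefXn eqSS.
  by rewrite (_ : (j == p :> nat) = false) ?mulr0 // eq_sym.
have coefQ0 c : (Q c)`_0 = mu (gF z) c.
  rewrite coefD coefC eqxx coef_sum big1 ?addr0 // => p _.
  by rewrite coefCM coefXn mulr0.
have [c Qc] : exists c, Q c != 0.
  apply/existsP; apply: contraNT z0; rewrite negb_exists => /forallP h.
  have {}h c : Q c = 0 by apply/eqP; rewrite -[_ == _]negbK.
  have g0 : gF 0 = 0 /\ gM 0 = 0 by have := gZ 0 0; rewrite !scale0r.
  apply/eqP/gI; rewrite ?g0.1 ?g0.2.
    apply: (fox_eq0 H); apply/ffunP => c; by rewrite -coefQ0 h coef0 ffunE.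
  apply/ffunP => j; have := coefQ i0 j; rewrite h coef0 ffunE => /esym/eqP.
  by rewrite mulf_eq0 (negbTE tau0) => /eqP.
exists (P * Q c); rewrite mulf_neq0 //; split=> // q.
rewrite hornerM mulf_eq0 negb_or => /andP[hq hQ] y.
rewrite in_cons => /orP[/eqP -> _|]; last exact: hP.
apply: contraNneq hQ => /ffunP/(_ c); rewrite !ffunE => E.
rewrite hornerD hornerC horner_sum -[X in _ == X]E; apply/eqP; congr (_ + _).
rewrite mulr_sumr; apply: eq_bigr => j _.
by rewrite hornerM hornerC hornerXn mulrA.
Qed.

Lemma combine_ucl : in_ucl F A.
Proof.
move=> f hf e.
have [P [P0 hP]] := combine_nonzero (atoms e f).
have [q hq] := mpoly_nonroot i0 P0.
have [chi [hchi E]] := combine_hom q.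
apply/(fholds_hom hchi); last exact: hf.
move=> z hz cz; apply/eqP; apply: contraT => z0.
by have := hP q hq z hz z0; rewrite -E cz (fox0 H) eqxx.
Qed.

End Discriminate.

(** Rank at least two supplies the nonzero cycle [kos i0 i1 1], the Fox vector of the product of the
    first two generators. *)
Lemma embeds_ucl (k : fieldType) r (F : lieAlg k) (a : 'I_r -> F) s (A : lieAlg k) :
  (1 < r)%N -> is_free_metabelian a -> embeds_Frs a s A -> in_ucl F A.
Proof.
move=> hr hF [gF [gM [gD [gZ [gB gI]]]]].
have [mu H] := magnus_embedding hF.
pose i0 := Ordinal (ltnW hr); pose i1 := Ordinal hr.
apply: (@combine_ucl _ _ _ _ _ H (kos i0 i1 1) i0 _ _ _ _ _ _ gD gZ gB gI).
  exact: bd_kos.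
rewrite !ffunE eqxx (_ : i0 == i1 = false) // mul1r mul0r subr0 mulr1.
by apply/eqP => /(congr1 (fun f => msize f)); rewrite msizeX msize0 mdeg1.
Qed.

(** * The axioms in the free metabelian Lie algebra *)

Section FreeAxioms.
Variables (k : fieldType) (r : nat) (F : lieAlg k) (a : 'I_r -> F).
Variable mu : F -> {ffun 'I_r -> {mpoly k[r]}}.
Hypothesis H : fox_derivation a mu.

(** If [bd d] is zero then [e] and [g] are cycles as well; otherwise both are proportional to [d]
    over the fraction field. *)
Lemma wbr_kill (d e g : {ffun 'I_r -> {mpoly k[r]}}) :
  d != 0 -> wbr d e = 0 -> wbr d g = 0 -> wbr e g = 0.
Proof.
move=> d0 /ffunP he /ffunP hg; have [b0|b0] := eqVneq (bd d) 0.
  have K f : (forall i, wbr d f i = (0 : {ffun 'I_r -> {mpoly k[r]}}) i) -> bd f = 0.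
    move=> hf; apply/eqP; apply: contraNT d0 => bf; apply/eqP; apply: modact_eq0 bf.
    by apply/ffunP => i; have := hf i; rewrite !ffunE b0 mulr0 subr0.
  by rewrite /wbr !K //; apply/ffunP => i; rewrite !ffunE !mulr0 subr0.
apply: modact_eq0 b0; apply/ffunP => i; have := hg i; have := he i.
rewrite !ffunE => /eqP; rewrite subr_eq0 => /eqP E1 /eqP; rewrite subr_eq0 => /eqP E2.
by rewrite mulrBl mulrAC -E1 [X in _ - X]mulrAC -E2 mulrAC subrr.
Qed.

Lemma free_phi3 (x y z : F) : x != 0 -> x ⋆ y = 0 -> x ⋆ z = 0 -> y ⋆ z = 0.
Proof.
move=> x0 hy hz; apply: (fox_eq0 H); rewrite (foxB H).
apply: (@wbr_kill (mu x)); rewrite -?(foxB H) ?hy ?hz ?(fox0 H) //.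
by apply: contraNneq x0 => /(fox_eq0 H) ->.
Qed.

(** If $xy\neq 0$, then $xy$ annihilates both $x$ and $y$, and [free_phi3] forces $xy=0$. *)
Lemma free_phi2 (x y : F) : x ⋆ y ⋆ x = 0 -> x ⋆ y ⋆ y = 0 -> x ⋆ y = 0.
Proof.
move=> hx hy; apply/eqP; apply: contraT => n0.
by have E := free_phi3 n0 hx hy; rewrite E eqxx in n0.
Qed.

Lemma free_fit (u : F) : derived u -> Fit_el u.
Proof.
move=> /(fox_derivedP H) hu y; apply: (fox_eq0 H); rewrite !(foxB H) {1}/wbr bd_wbr hu.
by apply/ffunP => i; rewrite !ffunE !mulr0 subr0.
Qed.

Lemma free_fit_comm (x y : F) : y ⋆ x ⋆ y = 0 -> bd (mu y) != 0 -> y ⋆ x = 0.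
Proof.
move=> /(congr1 mu); rewrite (foxB H) (fox0 H) /wbr {2}(foxB H) bd_wbr => h y0.
apply: (fox_eq0 H); apply: (modact_eq0 _ y0); rewrite -[RHS]h.
by apply/ffunP => i; rewrite !ffunE mulr0 subr0.
Qed.

Lemma mpolyXU_neq0 (i : 'I_r) : 'X_i != 0 :> {mpoly k[r]}.
Proof. by apply/eqP => /(congr1 (fun f => msize f)); rewrite msizeX msize0. Qed.

Lemma free_gen_br i j : i != j -> a i ⋆ a j != 0.
Proof.
move=> /negbTE ij; apply/eqP => /(congr1 mu); rewrite (foxB H) (fox0 H) !(fox_gen H).
move=> /ffunP/(_ i); rewrite !ffunE !bd_eps eqxx ij !mul1r mul0r mul0r subr0.
by apply/eqP/mpolyXU_neq0.
Qed.

Lemma bd_rank1 (d : {ffun 'I_r -> {mpoly k[r]}}) : (r <= 1)%N -> bd d = 0 -> d = 0.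
Proof.
move=> r1 /eqP; rewrite /bd => h; apply/ffunP => i; rewrite ffunE.
move: h; rewrite (bigD1 i) //= big1 ?addr0 => [|j].
  by rewrite mulf_eq0 (negbTE (mpolyXU_neq0 i)) orbF => /eqP.
case/negP; apply/eqP/val_inj; case: i j => [i hi] [j hj] /=.
by move: (leq_trans hi r1) (leq_trans hj r1); rewrite !ltnS !leqn0 => /eqP -> /eqP.
Qed.

Lemma free_torsion n (x : 'I_n -> F) (u : F) f : derived u ->
  mmap (@mpolyC r k) (fun i => bd (mu (x i))) f != 0 -> act u x f = 0 -> u = 0.
Proof.
move=> du f0 /(congr1 mu); rewrite (fox_act_derived H) // (fox0 H) => h.
exact/(fox_eq0 H)/(modact_eq0 h).
Qed.

Section Independent.
Variables (n : nat) (x : 'I_n -> F).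

Definition lin_mx : 'M[k]_(n, r) := \matrix_(i, j) (mu (x i) j)@_0%MM.

(** A linear relation between the linear parts is a nontrivial combination of the $x_i$ lying in the
    derived algebra, hence in the Fitting radical. *)
Lemma phi_row_free : phi x -> row_free lin_mx.
Proof.
move=> hx; rewrite -kermx_eq0; apply/negPn/negP => /rowV0Pn[v /sub_kermxP hv v0].
have [i hi] : exists i, v 0 i != 0.
  apply/existsP; apply: contraNT v0; rewrite negb_exists => /forallP h.
  by apply/eqP/rowP => i; rewrite mxE; apply/eqP; rewrite -[_ == _]negbK.
apply: (hx (fun i => v 0 i)); first by exists i.
apply/free_fit/(fox_derivedP H); rewrite (fox_bdE H); apply: big1 => j _.
have /rowP/(_ j) := hv; rewrite !mxE => E.
rewrite (fox_sum H) sum_ffunE raddf_sum /= -[RHS](scale0r ('X_j)); congr (_ *: _).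
rewrite -[RHS]E; apply: eq_bigr => l _.
by rewrite (foxZ H) ffunE mcoeffZ mxE.
Qed.

End Independent.

Lemma free_phi4 (x : 'I_r.+1 -> F) : ~ phi x.
Proof.
move=> /phi_row_free; rewrite /row_free => /eqP E.
by have := rank_leq_col (lin_mx x); rewrite E ltnn.
Qed.

(** * Fox Jacobians of tuples with independent linear parts *)

Section Jacobian.
Variables (n : nat) (Fn : lieAlg k) (an : 'I_n -> Fn).
Variable mun : Fn -> {ffun 'I_n -> {mpoly k[n]}}.
Hypothesis Hn : fox_derivation an mun.
Variable x : 'I_n -> F.
Variable B : 'M[k]_(r, n).
Hypothesis hB : lin_mx x *m B = 1%:M.

Local Notation ell := (fun i => bd (mu (x i))).
Local Notation sub := (mmap (@mpolyC r k) ell).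

(** A left inverse of the substitution of the linear forms [bd (mu (x i))] for the variables, built
    from the right inverse [B] of their coefficient matrix. *)
Definition eta : {mpoly k[r]} -> {mpoly k[n]} :=
  mmap (@mpolyC n k) (fun b => \sum_i B b i *: 'X_i).

HB.instance Definition _ := GRing.RMorphism.copy eta
  (mmap (@mpolyC n k) (fun b => \sum_i B b i *: 'X_i)).

Lemma etaE c (f g : {mpoly k[r]}) : eta (c *: f + g) = c *: eta f + eta g.
Proof. by rewrite /eta mmapD mmapZ mul_mpolyC. Qed.

Lemma eta_ell i : eta (ell i) = 'X_i.
Proof.
rewrite /= (fox_bdE H) /eta rmorph_sum /=.
under eq_bigr => b _ do rewrite mmapZ mmapX mmap1U mul_mpolyC scaler_sumr.
rewrite exchange_big /=.
under eq_bigr => j _ do (under eq_bigr => b _ do rewrite scalerA).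
under eq_bigr => j _ do rewrite -scaler_suml.
rewrite (bigD1 i) //= [X in _ + X]big1 => [|j ji].
  have /matrixP/(_ i i) := hB; rewrite !mxE eqxx mulr1n => E.
  rewrite addr0 -[RHS]scale1r -[in RHS]E; congr (_ *: _).
  by apply: eq_bigr => b _; rewrite mxE.
have /matrixP/(_ i j) := hB; rewrite !mxE eq_sym (negbTE ji) => E.
rewrite -[RHS](scale0r 'X_j); congr (_ *: _); rewrite -[RHS]E.
by apply: eq_bigr => b _; rewrite mxE.
Qed.

Lemma eta_sub f : eta (sub f) = f.
Proof.
move: f; apply: mpoly_lin_eq => [c f g|//|m].
  by rewrite mmapD mmapZ mul_mpolyC etaE.
rewrite mmapX /mmap1 rmorph_prod mpolyXE_id; apply: eq_bigr => i _ /=.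
by rewrite rmorphXn /= eta_ell.
Qed.

Lemma sub_neq0 f : f != 0 -> sub f != 0.
Proof. by apply: contraNneq => h; rewrite -(eta_sub f) h /eta mmap0. Qed.

Lemma eta_coeff0 f : (eta f)@_0%MM = f@_0%MM.
Proof.
move: f; apply: (@mpoly_lin_eq _ _ k^o) => [c f g|c f g|m].
- by rewrite etaE mcoeffD mcoeffZ.
- by rewrite mcoeffD mcoeffZ.
have [->|/mdegS_exists[i [m' ->]]] := eqVneq m 0%MM.
  by rewrite mpolyX0 rmorph1 !mcoeff1 !eqxx.
rewrite mpolyXD /eta rmorphM /= mmapX mmap1U !rmorphM /= raddf_sum /=.
rewrite mcoeffX mnm1_eq0 mul0r big1 ?mul0r // => j _.
by rewrite mcoeffZ mcoeffX mnm1_eq0 mulr0.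
Qed.

(** The change of rank on Fox vectors lying over [eta]: [B] acts on the basis and [eta] on the
    coefficients, so that [bd] is respected. *)
Definition push (d : {ffun 'I_r -> {mpoly k[r]}}) : {ffun 'I_n -> {mpoly k[n]}} :=
  [ffun i => \sum_b B b i *: eta (d b)].

Lemma pushP c d e : push (c *: d + e) = c *: push d + push e.
Proof.
apply/ffunP => i; rewrite !ffunE scaler_sumr -big_split; apply: eq_bigr => b _ /=.
by rewrite !ffunE etaE scalerDr !scalerA mulrC.
Qed.

Lemma push0 : push 0 = 0.
Proof. by have := pushP (-1) 0 0; rewrite scaler0 addr0 scaleN1r addNr. Qed.

Lemma pushD d e : push (d + e) = push d + push e.
Proof. by rewrite -(scale1r d) pushP !scale1r. Qed.

Lemma push_sum (I : Type) (s : seq I) (P : pred I) G :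
  push (\sum_(i <- s | P i) G i) = \sum_(i <- s | P i) push (G i).
Proof. exact: (big_morph push pushD push0). Qed.

Lemma push_modact d f : push (modact d f) = modact (push d) (eta f).
Proof.
apply/ffunP => i; rewrite !ffunE mulr_suml; apply: eq_bigr => b _.
by rewrite ffunE /eta rmorphM scalerAl.
Qed.

Lemma bd_push d : bd (push d) = eta (bd d).
Proof.
rewrite /bd rmorph_sum /=.
under eq_bigr => i _ do rewrite ffunE mulr_suml.
rewrite exchange_big; apply: eq_bigr => b _.
rewrite rmorphM /= [eta (mpolyX _ _)]mmapX mmap1U mulr_sumr; apply: eq_bigr => i _.
by rewrite -scalerAl -scalerAr.
Qed.

Definition rowf (d : {ffun 'I_n -> {mpoly k[n]}}) : 'rV[{mpoly k[n]}]_n := \row_i d i.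

Definition colX : 'cV[{mpoly k[n]}]_n := \col_i 'X_i.

Lemma rowf_colX d : (rowf d *m colX) 0 0 = bd d.
Proof. by rewrite mxE; apply: eq_bigr => i _; rewrite !mxE. Qed.

Definition jacobian : 'M[{mpoly k[n]}]_n := \matrix_(i, j) push (mu (x i)) j.

(** The row of index [i] of the Jacobian has image [eta (bd (mu (x i)))] under [bd], which is the
    variable $x_i$ of $R_n$. *)
Lemma jacobian_colX : jacobian *m colX = colX.
Proof.
apply/colP => i; rewrite !mxE -eta_ell -bd_push; apply: eq_bigr => j _.
by rewrite !mxE.
Qed.

(** Modulo $\Delta$ the Jacobian becomes [lin_mx x *m B], the identity. *)
Lemma det_jacobian0 : (\det jacobian)@_0%MM = 1.
Proof.
rewrite -[LHS](det_map_mx (mcoeff 0%MM)) -[RHS](det1 k n); congr (\det _).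
rewrite -hB; apply/matrixP => i j; rewrite !mxE ffunE raddf_sum /=.
by apply: eq_bigr => b _; rewrite mxE mcoeffZ eta_coeff0 mulrC.
Qed.

Lemma det_jacobian_neq0 : \det jacobian != 0.
Proof.
by apply/eqP => E; have := det_jacobian0; rewrite E mcoeff0 => /esym/eqP; rewrite oner_eq0.
Qed.

(** The chain rule of Fox calculus, by induction on the term. *)
Lemma fox_chain (t : lterm k 'I_n) :
  mu (teval x t) = \sum_i modact (mu (x i)) (sub (mun (teval an t) i)).
Proof.
(* Applying [bd] to the chain rule for a subterm gives its linear form after substitution, which the
   bracket case requires. *)
have bdE u (d : {ffun 'I_n -> {mpoly k[n]}}) : mu u = \sum_i modact (mu (x i)) (sub (d i)) -> bd (mu u) = sub (bd d).
  move=> ->; rewrite bd_sum [bd d]/bd rmorph_sum; apply: eq_bigr => i _ /=.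
  by rewrite bd_modact mulrC rmorphM /= mmapX mmap1U.
elim: t => [i||t1 IH1 t2 IH2|t IH|t1 IH1 t2 IH2|c t IH] /=.
- rewrite (fox_gen Hn) (bigD1 i) //= big1 ?addr0 => [|j /negbTE ji].
    by apply/ffunP => l; rewrite !ffunE eqxx mulr1 rmorph1 mulr1.
  by apply/ffunP => l; rewrite !ffunE ji mul0r rmorph0 mulr0.
- rewrite (fox0 H) (fox0 Hn) big1 // => i _; apply/ffunP => l.
  by rewrite !ffunE rmorph0 mulr0.
- rewrite (foxD H) (foxD Hn) IH1 IH2 -big_split; apply: eq_bigr => i _ /=.
  by apply/ffunP => l; rewrite !ffunE rmorphD mulrDr.
- rewrite (foxN H) (foxN Hn) IH -sumrN; apply: eq_bigr => i _ /=.
  by apply/ffunP => l; rewrite !ffunE rmorphN mulrN.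
- have E1 := bdE _ _ IH1; have E2 := bdE _ _ IH2.
  rewrite (foxB H) (foxB Hn) /wbr E1 E2 IH1 IH2; apply/ffunP => l.
  rewrite !ffunE !sum_ffunE !mulr_suml -sumrB; apply: eq_bigr => i _.
  by rewrite !ffunE rmorphB !rmorphM /= mulrBr !mulrA.
- rewrite (foxZ H) (foxZ Hn) IH scaler_sumr; apply: eq_bigr => i _ /=.
  by apply/ffunP => l; rewrite !ffunE mmapZ mul_mpolyC scalerAr.
Qed.

Lemma push_chain t :
  rowf (push (mu (teval x t))) = rowf (mun (teval an t)) *m jacobian.
Proof.
apply/rowP => i; rewrite fox_chain push_sum !mxE sum_ffunE; apply: eq_bigr => j _.
by rewrite push_modact ffunE eta_sub !mxE mulrC.
Qed.

Lemma rowf_inj d e : rowf d = rowf e -> d = e.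
Proof. by move=> /rowP h; apply/ffunP => i; have := h i; rewrite !mxE. Qed.

(** The Fox row of [t] times the Jacobian is zero, and the determinant of the Jacobian is
    nonzero. *)
Lemma free_phi6 (t : lterm k 'I_n) : teval x t = 0 -> teval an t = 0.
Proof.
move=> /(congr1 mu) E; have := push_chain t; rewrite E (fox0 H) push0.
move=> /(congr1 (fun M => M *m \adj jacobian)).
rewrite -mulmxA mul_mx_adj mul_mx_scalar (_ : rowf 0 = 0); last first.
  by apply/rowP => i; rewrite !mxE ffunE.
rewrite mul0mx => /rowP h; apply: (fox_eq0 Hn); apply/ffunP => i.
have /esym/eqP := h i; rewrite !mxE mulf_eq0 (negbTE det_jacobian_neq0) /= => /eqP ->.
by rewrite ffunE.
Qed.

(** After [push], the equations equate the row of [c i] times $J$ with the combination of the rows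
    of the [y j]. Multiplying by the adjugate solves the system with common denominator $\det J$,
    which lies outside $\Delta$. *)
Lemma free_phi7 (m l : nat) (f : 'I_m -> 'I_l -> {mpoly k[n]}) (c : 'I_m -> lterm k 'I_n)
    (y : 'I_l -> F) :
  (forall i, derived (teval an (c i))) -> (forall j, derived (y j)) ->
  (forall i, \sum_j act (y j) x (f i j) = teval x (c i)) ->
  solvable_loc an f (fun i => teval an (c i)).
Proof.
move=> dc dy hy; set J := jacobian.
pose v j := rowf (push (mu (y j))) *m \adj J.
have hv j : exists y', mun y' = [ffun i => v j 0 i] /\ derived y'.
  (* Since $J$ fixes the column of variables, its adjugate multiplies that column by $\det J$;
     cycles therefore stay cycles. *)
  have b0 : bd [ffun i => v j 0 i] = 0.
    rewrite -rowf_colX (_ : rowf _ = v j); last by apply/rowP => i; rewrite mxE ffunE.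
    rewrite /v -mulmxA -[colX]jacobian_colX [\adj J *m _]mulmxA mul_adj_mx mul_scalar_mx.
    rewrite -scalemxAr mxE rowf_colX bd_push.
    by have /(fox_derivedP H) -> := dy j; rewrite rmorph0 mulr0.
  have [y' hy'] := fox_surj Hn (syz_linform b0).
  by exists y'; split=> //; apply/(fox_derivedP Hn); rewrite hy'.
pose y' j := proj1_sig (constructive_indefinite_description _ (hv j)).
have hy' j : mun (y' j) = [ffun i => v j 0 i] /\ derived (y' j).
  by rewrite /y'; case: constructive_indefinite_description.
exists (\det J), y'; split; first by rewrite det_jacobian0 oner_neq0.
split=> [j|i]; first by case: (hy' j).
exists 1; split; first by rewrite mcoeff1 eqxx oner_neq0.
rewrite act1; apply: (fox_eq0 Hn); apply/rowf_inj.
rewrite (foxD Hn) (foxN Hn) (fox_sum Hn) (fox_act_gen Hn) //.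
rewrite (eq_bigr (fun j => modact [ffun p => v j 0 p] (f i j))); last first.
  by move=> j _; have [<- dy'] := hy' j; rewrite (fox_act_gen Hn).
have E : rowf (mun (teval an (c i))) *m J = \sum_j f i j *: rowf (push (mu (y j))).
  rewrite -push_chain -hy (fox_sum H) push_sum; apply/rowP => p.
  rewrite !mxE sum_ffunE summxE; apply: eq_bigr => j _.
  by rewrite (fox_act_derived H) // push_modact ffunE eta_sub !mxE mulrC.
have := congr1 (fun M => M *m \adj J) E.
rewrite -mulmxA mul_mx_adj mul_mx_scalar mulmx_suml => /rowP E'.
apply/rowP => p; have := E' p; rewrite !mxE summxE ffunE sum_ffunE !ffunE mulrC => ->.
rewrite (_ : \sum_j _ = \sum_j (f i j *: rowf (push (mu (y j))) *m \adj J) 0 p) ?subrr //.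
apply: eq_bigr => j _; rewrite !ffunE -scalemxAl. by rewrite [RHS]mxE mulrC.
Qed.

End Jacobian.
End FreeAxioms.

(** * Transfer of quantifier-free types *)

Section Transfer.
Variable k : fieldType.

Definition fall (I : Type) (s : seq I) (G : I -> qform k) : qform k :=
  foldr (fun i f => FAnd (G i) f) (FEq (TZero k nat) (TZero k nat)) s.

Lemma fholds_fall (A : lieAlg k) (e : nat -> A) (I : eqType) (s : seq I) G :
  fholds e (fall s G) <-> forall i, i \in s -> fholds e (G i).
Proof.
elim: s => [|i s IH] //=; split=> [[hi /IH hs] j|h].
  by rewrite in_cons => /orP[/eqP ->|/hs].
split; first by apply: h; rewrite mem_head.
by apply/IH => j hj; apply: h; rewrite in_cons hj orbT.
Qed.

(** The negation of the system is a universal sentence false in [A], hence false in [B]. Variables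
    from [V] are coded by numbers through [pickle]. *)
Lemma ucl_transfer (A B : lieAlg k) (V : countType) (e : V -> A) (I J : finType)
    (E : I -> lterm k V) (N : J -> lterm k V) : in_ucl B A ->
  (forall i, teval e (E i) = 0) -> (forall j, teval e (N j) <> 0) ->
  exists e' : V -> B, (forall i, teval e' (E i) = 0) /\ (forall j, teval e' (N j) <> 0).
Proof.
move=> hucl hE hN.
pose tn (t : lterm k V) : qform k := FEq (tmap pickle t) (TZero k nat).
pose f : qform k := FNot (FAnd (fall (enum I) (fun i => tn (E i)))
                        (fall (enum J) (fun j => FNot (tn (N j))))).
have nf : ~ usat A f.
  pose en m : A := oapp e 0 (unpickle m).
  have ee t : teval en (tmap pickle t) = teval e t.
    by rewrite teval_map; apply: teval_ext => v; rewrite /en pickleK.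
  move=> /(_ en) /=; apply; split; apply/fholds_fall => i _ /=; rewrite ee //.
have /not_all_ex_not[e' /NNPP /= [/fholds_fall h1 /fholds_fall h2]] : ~ usat B f.
  by move=> /hucl.
exists (fun v => e' (pickle v)); split=> i; rewrite -teval_map.
  by have := h1 i (mem_enum _ i).
exact: (h2 i (mem_enum _ i)).
Qed.

End Transfer.

Definition sumenv (X V W : Type) (x : V -> X) (e : W -> X) (v : V + W) : X :=
  match v with inl i => x i | inr w => e w end.

(** Finiteness of [k] makes [phi] finitely many conditions. A witness against [Fit_el] for each
    nonzero coefficient vector becomes a new variable with one more inequation. *)
Lemma phi_transfer (k : finFieldType) (A B : lieAlg k) n (x : 'I_n -> A)
    (V : countType) (e : V -> A) (I J : finType)
    (E : I -> lterm k ('I_n + V)%type) (N : J -> lterm k ('I_n + V)%type) :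
  in_ucl B A -> phi x ->
  (forall i, teval (sumenv x e) (E i) = 0) -> (forall j, teval (sumenv x e) (N j) <> 0) ->
  exists (x' : 'I_n -> B) (e' : V -> B), phi x' /\
    (forall i, teval (sumenv x' e') (E i) = 0) /\
    (forall j, teval (sumenv x' e') (N j) <> 0).
Proof.
move=> hucl hx hE hN.
pose Z := {al : {ffun 'I_n -> k} | al != 0}.
have wit (al : Z) : exists y, (\sum_i val al i *: x i) ⋆ y ⋆ (\sum_i val al i *: x i) <> 0.
  apply: not_all_ex_not; apply: hx; apply/existsP; case: al => al /=.
  apply: contraNT; rewrite negb_exists => /forallP h; apply/eqP/ffunP => i.
  by rewrite ffunE; apply/eqP; rewrite -[_ == _]negbK.
pose y (al : Z) := proj1_sig (constructive_indefinite_description _ (wit al)).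
have hy (al : Z) : (\sum_i val al i *: x i) ⋆ y al ⋆ (\sum_i val al i *: x i) <> 0.
  by rewrite /y; case: constructive_indefinite_description.
pose W := (('I_n + V) + Z)%type.
pose tz (al : Z) : lterm k W :=
  tsum (enum 'I_n) (fun i => TScale (val al i) (TVar k (inl (inl i)))).
pose N' (j : J + Z) : lterm k W :=
  match j with
  | inl j => tmap inl (N j)
  | inr al => TBr (TBr (tz al) (TVar k (inr al))) (tz al)
  end.
have tzE (C : lieAlg k) (e0 : W -> C) (al : Z) :
    teval e0 (tz al) = \sum_i val al i *: e0 (inl (inl i)).
  by rewrite teval_sum big_enum.
have [|j|e' [h1 h2]] := @ucl_transfer k A B W (sumenv (sumenv x e) y) I (J + Z)%type
  (fun i => tmap inl (E i)) N' hucl.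
- by move=> i; rewrite teval_map.
- by case: j => [j|al] /=; [rewrite teval_map; apply: hN|rewrite tzE; apply: hy].
have ext t : teval (fun v => e' (inl v)) t =
    teval (sumenv (fun i => e' (inl (inl i))) (fun v => e' (inl (inr v)))) t.
  by apply: teval_ext; case.
exists (fun i => e' (inl (inl i))), (fun v => e' (inl (inr v))); split; [|split].
- move=> al [i ali] hfit.
  have nz : finfun al != 0 by apply: contraNneq ali => /ffunP/(_ i); rewrite !ffunE => ->.
  have := h2 (inr (exist _ (finfun al) nz)); rewrite /= !tzE; apply.
  under eq_bigr => p _ do rewrite ffunE.
  exact: hfit.
- by move=> i; rewrite -ext -teval_map.
- by move=> j; rewrite -ext -teval_map; apply: (h2 (inl j)).
Qed.

(** * The axioms hold in the universal closure of $F_r$ *)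

Section UclPhi.
Variables (k : finFieldType) (F : nat -> lieAlg k) (a : forall n : nat, 'I_n -> F n).
Hypothesis hF : forall n : nat, is_free_metabelian (@a n).
Variable r : nat.

Lemma phi_right_inverse n (x : 'I_n -> F r) mu : fox_derivation (@a r) mu -> phi x ->
  exists B, lin_mx mu x *m B = 1%:M.
Proof. by move=> H /(phi_row_free H)/row_freeP. Qed.

Lemma ucl_Phi (A : lieAlg k) : metabelian A -> in_ucl (F r) A -> Phi_alg a r A.
Proof.
move=> hA hucl; have [mu H] := magnus_embedding (hF r).
split=> //; split; [|split; [|split; [|split; [|split]]]].
- move=> x y h1 h2; apply: NNPP => h3.
  pose X := TVar k false; pose Y := TVar k true.
  have [||e [E N]] := @ucl_transfer k A (F r) bool (fun b => if b then y else x) bool unit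
    (fun b => TBr (TBr X Y) (if b then Y else X)) (fun=> TBr X Y) hucl.
  + by case.
  + by [].
  by have := N tt; apply; apply: (free_phi2 H); [have := E false | have := E true].
- move=> x y z /eqP x0 h1 h2; apply: NNPP => h3.
  pose X := TVar k (Some false); pose Y := TVar k (Some true); pose Z := TVar k (@None bool).
  have [||e [E N]] := @ucl_transfer k A (F r) (option bool)
    (fun b => if b is Some b then if b then y else x else z) bool bool
    (fun b => TBr X (if b then Y else Z)) (fun b => if b then X else TBr Y Z) hucl.
  + by case.
  + by case.
  have := N false; apply.
  by apply: (free_phi3 H _ (E true) (E false)); apply/eqP/(N true).
- move=> x hx.
  have [||x' [_ [hx' _]]] := @phi_transfer k A (F r) _ x void (of_void A) void void
    (of_void _) (of_void _) hucl hx; try by case.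
  exact: (free_phi4 H hx').
- move=> n hn f f0 z1 z2 x h1 /eqP h2 hx.
  pose T := TBr (TVar k (inr false)) (TVar k (inr true)) : lterm k ('I_n + bool).
  have [||x' [e' [hx' [E N]]]] := @phi_transfer k A (F r) _ x bool (fun b => if b then z2 else z1)
    unit unit (fun=> tact T (fun i => TVar k (inl i)) f) (fun=> T) hucl hx.
  + by move=> _; rewrite teval_act /=.
  + by [].
  have [B hB] := phi_right_inverse H hx'.
  have := N tt; apply; have := E tt; rewrite teval_act.
  apply: (free_torsion H); first exact: derived_br.
  exact: (sub_neq0 H hB).
- move=> n hn t /eqP t0 x hx; apply/negP => /eqP h.
  have [||x' [e' [hx' [E N]]]] := @phi_transfer k A (F r) _ x void (of_void A)
    unit void (fun=> tmap inl t) (of_void _) hucl hx.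
  + by move=> _; rewrite teval_map.
  + by case.
  have [B hB] := phi_right_inverse H hx'; have [mun Hn] := magnus_embedding (hF n).
  by apply: t0; apply: (free_phi6 H Hn hB); have := E tt; rewrite teval_map.
- move=> n /andP[n0 hn] m l f c dc nsol x y hx hy; apply: NNPP => hno.
  have {}hno i : \sum_(j < l) act (y j) x (f i j) = teval x (c i).
    apply/eqP; rewrite -subr_eq0; apply: contraT => h; case: hno; by exists i.
  have [mun Hn] := magnus_embedding (hF n).
  have X i : lterm k ('I_n + 'I_l)%type := TVar k (inl i).
  have [||x' [y' [hx' [E N]]]] := @phi_transfer k A (F r) _ x 'I_l y ('I_m + 'I_l * 'I_n)%type void
    (fun v => match v with
      | inl i => TAdd (tsum (enum 'I_l) (fun j =>
                    tact (TVar k (inr j)) (fun p => TVar k (inl p)) (f i j)))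
                  (TOpp (tmap inl (c i)))
      | inr (j, i) => TBr (TBr (TVar k (inr j)) (TVar k (inl i))) (TVar k (inr j))
      end) (of_void _) hucl hx.
  + case=> [i|[j i]] /=; last exact: hy.
    rewrite teval_sum teval_map big_enum /= -hno; apply/eqP; rewrite subr_eq0; apply/eqP.
    by apply: eq_bigr => j _; rewrite teval_act.
  + by case.
  have [B hB] := phi_right_inverse H hx'.
  have eqs i : \sum_j act (y' j) x' (f i j) = teval x' (c i).
    have := E (inl i); rewrite /= teval_sum teval_map big_enum /= => /eqP.
    rewrite subr_eq0 => /eqP <-; by apply: eq_bigr => j _; rewrite teval_act.
  (* For $n=1$ the module $\mathrm{Fit}(F_1)$ is zero, so all [c i] vanish and the zero tuple is a
     solution. *)
  apply: nsol; have [n1|n1] := leqP n 1.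
    have c0 i : teval (@a n) (c i) = 0.
      apply: (fox_eq0 Hn); apply: bd_rank1 => //; exact/(fox_derivedP Hn)/dc.
    exists 1, (fun=> 0); split; first by rewrite mcoeff1 eqxx oner_neq0.
    split=> [j|i]; first exact: derived0.
    exists 1; split; first by rewrite mcoeff1 eqxx oner_neq0.
    rewrite c0 act0l subr0 big1 ?act0l // => j _; exact: act0l.
  (* The [y' j] lie in the derived algebra: otherwise some [y' j] would commute with all $x_i$, so
     the first two $x_i$ would commute by [free_phi3], against [free_phi6]. *)
  apply: (free_phi7 H Hn hB dc _ eqs) => j.
  apply/(fox_derivedP H)/eqP; apply: contraT => yj0.
  have yx i : y' j ⋆ x' i = 0 by apply: (free_fit_comm H) yj0; have := E (inr (j, i)).
  have yj1 : y' j != 0 by apply: contraNneq yj0 => ->; rewrite (fox0 H) bd0.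
  pose i0 := Ordinal n0; pose i1 := Ordinal n1.
  have := free_phi3 H yj1 (yx i0) (yx i1).
  move/(free_phi6 H Hn hB (t := TBr (TVar k i0) (TVar k i1))) => /= e01.
  by have := free_gen_br Hn (erefl : i0 != i1); rewrite e01 eqxx.
Qed.

End UclPhi.

(** * Noetherian modules *)

Section Noetherian.

Definition submod (R : pzRingType) (V : lmodType R) (K : V -> Prop) : Prop :=
  [/\ K 0, forall x y, K x -> K y -> K (x + y) & forall (c : R) x, K x -> K (c *: x)].

(** Generation is expressed through the submodules containing the list, so generated elements are
    reached by proving closure properties of a predicate. *)
Definition fgen (R : pzRingType) (V : lmodType R) (K : V -> Prop) : Prop :=
  exists s : seq V, (forall y, y \in s -> K y) /\
    forall K', submod K' -> (forall y, y \in s -> K' y) -> forall x, K x -> K' x.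

Definition noetherian (R : pzRingType) (V : lmodType R) : Prop :=
  forall K : V -> Prop, submod K -> fgen K.

Lemma submodB (R : pzRingType) (V : lmodType R) (K : V -> Prop) x y :
  submod K -> K x -> K y -> K (x - y).
Proof. by move=> [_ KD KZ] hx hy; rewrite -scaleN1r; apply: KD => //; apply: KZ. Qed.

Lemma seq_choice (T : eqType) (U : Type) (u0 : U) (s : seq T) (P : T -> U -> Prop) :
  (forall x, x \in s -> exists u, P x u) -> exists f, forall x, x \in s -> P x (f x).
Proof.
move=> h; exists (fun x => epsilon (inhabits u0) (P x)) => x xs.
exact: epsilon_spec (h x xs).
Qed.

Lemma noetherian_field (k : fieldType) : noetherian k^o.
Proof.
move=> K [K0 KD KZ]; have [[x [hx x0]]|no] := classic (exists x : k, K x /\ x <> 0).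
  exists [:: x]; split=> [y|K' [_ _ KZ'] hK' y _]; first by rewrite inE => /eqP ->.
  have := KZ' (y / x) x (hK' x (mem_head _ _)).
  by rewrite -[_ *: _]/(_ * _) divfK //; apply/eqP.
exists [::]; split=> // K' [K0' _ _] _ x hx.
have [->|/eqP x0] := eqVneq x 0; first exact: K0'.
by case: no; exists x.
Qed.

Lemma noetherian_surj (R S : pzRingType) (f : {rmorphism S -> R}) :
  (forall x, exists y, f y = x) -> noetherian S^o -> noetherian R^o.
Proof.
move=> fsurj hS K [K0 KD KZ].
have sub (L : R^o -> Prop) : submod L -> submod (fun x : S^o => L (f x)).
  move=> [L0 LD LZ]; split=> [|x y hx hy|c x hx]; rewrite ?rmorph0 ?rmorphD ?rmorphM //.
    exact: LD.
  exact: LZ.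
have [s [hs gs]] := hS _ (sub K (And3 K0 KD KZ)).
exists [seq f x | x <- s]; split=> [y /mapP[x xs ->]|K' hK' h y]; first exact: hs.
have [x <-] := fsurj y; apply: (gs _ (sub _ hK')) => z zs.
by apply/h/map_f.
Qed.

(** * Hilbert's basis theorem *)

Section Hilbert.
Variables (R : comNzRingType) (hR : noetherian R^o).
Variables (K : {poly R}^o -> Prop) (hK : submod K).

Definition lc (N : nat) (c : R) : Prop := exists p, [/\ K p, (size p <= N.+1)%N & p`_N = c].

Lemma lc_shift (L : {poly R} -> Prop) (N M : nat) c : (forall q p, L p -> L (q * p)) ->
  (exists p, [/\ L p, (size p <= N.+1)%N & p`_N = c]) -> (N <= M)%N ->
  exists p, [/\ L p, (size p <= M.+1)%N & p`_M = c].
Proof.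
move=> LM [p [hp sp <-]] NM; exists ('X^(M - N) * p); split; first exact: LM.
  have [->|p0] := eqVneq p 0; first by rewrite mulr0 size_poly0.
  by rewrite mulrC size_mulXn // (leq_trans (leq_add (leqnn _) sp)) // addnS subnK.
by rewrite coefXnM ltnNge leq_subr /= subKn.
Qed.

Lemma lc_submod (L : {poly R}^o -> Prop) N : submod L ->
  submod (fun c : R^o => exists p : {poly R}, [/\ L p, (size p <= N.+1)%N & p`_N = c]).
Proof.
move=> [L0 LD LZ]; split.
- by exists 0; rewrite size_poly0 coef0.
- move=> x y [p [hp sp <-]] [q [hq sq <-]]; exists (p + q); split; first exact: LD.
    by rewrite (leq_trans (size_polyD _ _)) // geq_max sp.
  by rewrite coefD.
- move=> c x [p [hp sp <-]]; exists (c *: p); split.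
  + by rewrite -mul_polyC; apply: (LZ c%:P p).
  + exact: leq_trans (size_scale_leq _ _) sp.
  + by rewrite coefZ.
Qed.

Lemma lc_union_submod : submod (fun c : R^o => exists N, lc N c).
Proof.
have [K0 KD KZ] := hK; split.
- by exists 0%N, 0; rewrite size_poly0 coef0.
- move=> x y [N hN] [M hM].
  have KM (q p : {poly R}) : K p -> K (q * p) by apply: KZ.
  have hN' := lc_shift KM hN (leq_maxl N M); have hM' := lc_shift KM hM (leq_maxr N M).
  by exists (maxn N M); have [_ h _] := lc_submod (maxn N M) hK; apply: h.
- by move=> c x [N hN]; exists N; have [_ _ h] := lc_submod N hK; apply: h.
Qed.

(** Generators of the ideal of all leading coefficients serve in degrees at least [D]; separate
    finite lists serve in each degree below [D]. *)
Lemma hilbert_fgen : fgen K.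
Proof.
have [K0 KD KZ] := hK.
have KM (q p : {poly R}) : K p -> K (q * p) by apply: KZ.
have [s [hs gs]] := hR lc_union_submod.
have [D hD] : exists D, forall c, c \in s -> lc D c.
  elim: s hs {gs} => [|c s IH] hs; first by exists 0%N.
  have [|D hD] := IH; first by move=> y ys; apply: hs; rewrite in_cons ys orbT.
  have [N hN] := hs c (mem_head _ _).
  exists (maxn N D) => y; rewrite in_cons => /orP[/eqP ->|/hD hy].
    exact: lc_shift KM hN (leq_maxl _ _).
  exact: lc_shift KM hy (leq_maxr _ _).
have [g hg] := seq_choice 0 hD.
have lows M : exists t : seq {poly R}, (forall p, p \in t -> K p) /\
    forall K', submod (K' : {poly R}^o -> Prop) -> (forall p, p \in t -> K' p) ->
    forall N c, (N < M)%N -> lc N c ->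
    exists p, [/\ K p /\ K' p, (size p <= N.+1)%N & p`_N = c].
  elim: M => [|M [t [ht gt]]]; first by exists [::].
  have [u [hu gu]] := hR (lc_submod M hK).
  have [g' hg'] := seq_choice 0 hu.
  exists ([seq g' c | c <- u] ++ t); split=> [p|K' hK' hall N c].
    rewrite mem_cat => /orP[/mapP[c cu ->]|/ht //]; by have [] := hg' c cu.
  have ht' p : p \in t -> K' p by move=> pt; apply: hall; rewrite mem_cat pt orbT.
  rewrite ltnS leq_eqVlt => /orP[/eqP ->|NM]; last exact: gt.
  have KK : submod (fun p : {poly R}^o => K p /\ K' p).
    case: hK' => K0' KD' KZ'; split=> // [x y [? ?] [? ?]|b x [? ?]].
      by split; [apply: KD|apply: KD'].
    by split; [apply: KZ|apply: KZ'].
  apply: (gu _ (lc_submod M KK)) => y yu; have [h1 h2 h3] := hg' y yu.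
  exists (g' y); split=> //; split=> //; apply: hall; rewrite mem_cat map_f //.
have [t [ht gt]] := lows D.
exists ([seq g c | c <- s] ++ t); split=> [p|K' hK' hall p].
  rewrite mem_cat => /orP[/mapP[c cu ->]|/ht //]; by have [] := hg c cu.
have ht' q : q \in t -> K' q by move=> pt; apply: hall; rewrite mem_cat pt orbT.
have KK : submod (fun p : {poly R}^o => K p /\ K' p).
  case: hK' => K0' KD' KZ'; split=> // [x y [? ?] [? ?]|b x [? ?]].
    by split; [apply: KD|apply: KD'].
  by split; [apply: KZ|apply: KZ'].
have KKM (q r : {poly R}) : K r /\ K' r -> K (q * r) /\ K' (q * r).
  by case: KK => _ _ h; apply: h.
(* Every leading coefficient of an element of [K] is attained, at the same degree bound, inside the
   intersection of [K] and [K']; subtracting that element lowers the size. *)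
have top N c : lc N c -> exists q, [/\ K q /\ K' q, (size q <= N.+1)%N & q`_N = c].
  move=> hc; have [ND|DN] := ltnP N D; first exact: gt.
  apply: (gs _ (lc_submod N KK)); last by exists N.
  move=> y ys; apply: (lc_shift KKM _ DN); have [h1 h2 h3] := hg y ys.
  exists (g y); split=> //; split=> //; apply: hall; rewrite mem_cat map_f //.
have [N] := ubnP (size p); elim: N p => // N IH p; rewrite ltnS => sp hp.
have [p0|p0] := eqVneq (size p) 0%N.
  by move/eqP: p0; rewrite size_poly_eq0 => /eqP ->; case: hK'.
have sE : size p = (size p).-1.+1 by rewrite prednK // lt0n.
have [|q [[hq hq'] sq cq]] := top (size p).-1 (lead_coef p).
  by exists p; rewrite -sE.
rewrite -[p](subrK q); case: (hK') => _ h _; apply: h => //.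
apply: IH; last exact: submodB hK _ _.
rewrite (leq_trans _ sp) // sE ltnS; apply/leq_sizeP => j; rewrite leq_eqVlt.
move=> /orP[/eqP <-|hj]; first by rewrite coefB cq subrr.
by rewrite coefB (nth_default _ (leq_trans sq hj)) nth_default ?subrr // sE.
Qed.

End Hilbert.

Lemma noetherian_poly (R : comNzRingType) : noetherian R^o -> noetherian {poly R}^o.
Proof. move=> hR K hK; exact: hilbert_fgen. Qed.

(** Evaluation at the last variable maps polynomials over $k[x_1,\dots,x_n]$ onto the ring in one
    more variable, and surjectivity suffices. *)
Lemma noetherian_mpoly (k : fieldType) n : noetherian {mpoly k[n]}^o.
Proof.
elim: n => [|n IH].
  apply: (@noetherian_surj _ k (@mpolyC 0 k)); last exact: noetherian_field.
  by move=> p; exists (p@_0%MM); apply/esym/nvar0_mpolyC.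
have co : commr_rmorph (@mwiden n k) ('X_ord_max : {mpoly k[n.+1]}) by move=> x; apply: mulrC.
apply: (noetherian_surj (f := horner_morph co)); last exact: noetherian_poly.
pose P (p : {mpoly k[n.+1]}) := exists q, horner_morph co q = p.
have PD p q : P p -> P q -> P (p + q).
  by move=> [p' <-] [q' <-]; exists (p' + q'); rewrite rmorphD.
have PM p q : P p -> P q -> P (p * q).
  by move=> [p' <-] [q' <-]; exists (p' * q'); rewrite rmorphM.
have PC c : P c%:MP.
  by exists (c%:MP)%:P; rewrite [LHS]horner_morphC; apply: mwidenC.
have PX i : P 'X_i.
  have [i' ->|->] := unliftP ord_max i; last by exists 'X; rewrite /= horner_morphX.
  exists ('X_i')%:P; rewrite [LHS]horner_morphC [LHS]mwidenX mnmwiden1; congr 'X_(_).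
  by apply/val_inj; rewrite /= /bump leqNgt ltn_ord.
move=> p; apply: (mpolyind (P := P)) => [|c m q _ _ hq]; first by rewrite -mpolyC0; apply: PC.
apply: PD => //; rewrite -mul_mpolyC mpolyXE_id; apply: (PM); first exact: PC.
apply: big_ind => [||i _]; [by rewrite -mpolyC1; apply: PC|exact: PM|].
by elim: (m i) => [|j IHj]; [rewrite expr0 -mpolyC1; apply: PC|rewrite exprS; apply: (PM)].
Qed.

Lemma noetherian_rows (R : comNzRingType) l : noetherian R^o -> noetherian 'rV[R]_l.
Proof.
move=> hR K hK; have [K0 KD KZ] := hK.
(* A filtration of [K] by the rows that vanish from coordinate [j] on; each step adds lifts of
   generators for the ideal of the next coordinates. *)
pose Kj j (v : 'rV[R]_l) := K v /\ forall i : 'I_l, (j <= i)%N -> v 0 i = 0.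
suff h j : (j <= l)%N -> fgen (Kj j).
  have [s [hs gs]] := h l (leqnn l); exists s; split=> [y /hs[]//|K' hK' h' x hx].
  by apply: (gs _ hK' h'); split=> // i; rewrite leqNgt ltn_ord.
have subKj i : submod (Kj i).
  split=> [|x y [hx zx] [hy zy]|c x [hx zx]].
  - by split=> // p _; rewrite mxE.
  - by split; [apply: KD|move=> p hp; rewrite mxE zx // zy // addr0].
  - by split; [apply: KZ|move=> p hp; rewrite mxE zx // mulr0].
elim: j => [|j IH] jl.
  exists [::]; split=> // K' [K0' _ _] _ x [_ zx].
  by rewrite (_ : x = 0) //; apply/rowP => i; rewrite zx // mxE.
have [s [hs gs]] := IH (ltnW jl); pose o := Ordinal jl.
pose J (c : R^o) := exists v, Kj j.+1 v /\ v 0 o = c.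
have subJ (L : 'rV[R]_l -> Prop) : submod L -> submod (fun c : R^o => exists v, L v /\ v 0 o = c).
  move=> [L0 LD LZ]; split.
  - by exists 0; rewrite mxE.
  - by move=> x y [v [hv <-]] [w [hw <-]]; exists (v + w); split; [apply: LD|rewrite mxE].
  - by move=> c x [v [hv <-]]; exists (c *: v); split; [apply: LZ|rewrite mxE].
have [t [ht gt]] := hR _ (subJ _ (subKj j.+1)).
have [g hg] := seq_choice 0 ht.
exists ([seq g c | c <- t] ++ s); split=> [y|K' hK' hall x hx].
  rewrite mem_cat => /orP[/mapP[c ct ->]|/hs[hy zy]]; first by have [] := hg c ct.
  by split=> // i ji; apply: zy; apply: ltnW.
have KK : submod (fun v => Kj j.+1 v /\ K' v).
  case: hK' => K0' KD' KZ'; have [K0j KDj KZj] := subKj j.+1.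
  split=> // [y z [? ?] [? ?]|b y [? ?]].
    by split; [apply: KDj|apply: KD'].
  by split; [apply: KZj|apply: KZ'].
have [||v [[hv hv'] ev]] := gt _ (subJ _ KK) _ (x 0 o).
- move=> c ct; have [h1 h2] := hg c ct; exists (g c); split=> //; split=> //.
  by apply: hall; rewrite mem_cat map_f.
- by exists x.
rewrite -[x](subrK v); case: (hK') => _ h _; apply: h => //.
apply: (gs _ hK').
  by move=> y ys; apply: hall; rewrite mem_cat ys orbT.
split; first by apply: (submodB hK); [case: hx|case: hv].
move=> i; rewrite leq_eqVlt => /orP[/eqP ji|ji].
  by rewrite (_ : i = o) ?mxE ?ev ?subrr //; apply/val_inj.
by rewrite !mxE hx.2 // hv.2 // subrr.
Qed.

End Noetherian.

(** * Embedding a finitely generated torsion-free module in a free module *)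

Lemma fgen_matrix (R : comNzRingType) l (K : 'rV[R]_l -> Prop) :
  submod K -> fgen K ->
  exists g (G : 'M[R]_(g, l)), forall p, K p <-> exists w : 'rV_g, p = w *m G.
Proof.
move=> [K0 KD KZ] [s [hs gs]]; pose G : 'M[R]_(size s, l) := \matrix_i s`_i.
exists (size s), G => p; split.
  move: p; apply: gs => [|y ys].
    split; first by exists 0; rewrite mul0mx.
      by move=> x y [w ->] [v ->]; exists (w + v); rewrite mulmxDl.
    by move=> c x [w ->]; exists (c *: w); rewrite -scalemxAl.
  have iy : (index y s < size s)%N by rewrite index_mem.
  exists (delta_mx 0 (Ordinal iy)); rewrite -rowE rowK /= nth_index //.
move=> [w ->]; rewrite mulmx_sum_row; apply: big_ind => // i _.
by apply/KZ/hs; rewrite rowK mem_nth.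
Qed.

Lemma frac_clear (R : idomainType) (x : {fraction R}) :
  exists d n : R, d != 0 /\ FracField.tofrac d * x = FracField.tofrac n.
Proof.
elim/quotW: x => y; exists (frac y).2, (frac y).1; split; first exact: denom_ratioP.
rewrite -[_ * _]/(FracField.mul _ _) !piE; apply/eqP; rewrite FracField.equivf_def.
by rewrite /FracField.mulf !numden_Ratio ?mul1r ?mulr1 ?oner_neq0 ?denom_ratioP.
Qed.

Lemma frac_clear_mx (R : idomainType) m n (M : 'M[{fraction R}]_(m, n)) :
  exists (q : R) (N : 'M[R]_(m, n)), q != 0 /\
    map_mx (@FracField.tofrac R) N = FracField.tofrac q *: M.
Proof.
have cl (ij : 'I_m * 'I_n) : exists dn : R * R, dn.1 != 0 /\
    FracField.tofrac dn.1 * M ij.1 ij.2 = FracField.tofrac dn.2.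
  by have [d [c h]] := frac_clear (M ij.1 ij.2); exists (d, c).
pose f ij := proj1_sig (constructive_indefinite_description _ (cl ij)).
have hf ij : (f ij).1 != 0 /\ FracField.tofrac (f ij).1 * M ij.1 ij.2 = FracField.tofrac (f ij).2.
  by rewrite /f; case: constructive_indefinite_description.
exists (\prod_ij (f ij).1),
  (\matrix_(i, j) ((f (i, j)).2 * \prod_(p | p != (i, j)) (f p).1)); split.
  by apply/prodf_neq0 => ij _; case: (hf ij).
apply/matrixP => i j; rewrite !mxE [in RHS](bigD1 (i, j)) //= !rmorphM /=.
by have [_ <-] := hf (i, j); rewrite mulrAC.
Qed.

(** Over the fraction field the row space of the generators is the kernel of their cokernel matrix,
    whose denominators are cleared to give [C]. A row in that space has a nonzero multiple in [K],
    hence lies in [K] by saturation. *)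
Lemma saturated_kernel (R : idomainType) l (K : 'rV[R]_l -> Prop) :
  submod K -> fgen K -> (forall q p, q != 0 -> K (q *: p) -> K p) ->
  exists C : 'M[R]_l, forall p, K p <-> p *m C = 0.
Proof.
move=> subK fgK sat; have [g [G hG]] := fgen_matrix subK fgK.
pose phi_mx m n := @map_mx _ _ (@FracField.tofrac R) m n.
have inj m n (M N : 'M[R]_(m, n)) : phi_mx m n M = phi_mx m n N -> M = N.
  move=> /matrixP h; apply/matrixP => i j; apply/eqP.
  by rewrite -tofrac_eq; apply/eqP; have := h i j; rewrite !mxE.
have [q [C [q0 hC]]] := frac_clear_mx (cokermx (phi_mx _ _ G)).
have q0F : FracField.tofrac q != 0 by rewrite tofrac_eq0.
have key (p : 'rV[R]_l) : p *m C = 0 <-> (phi_mx _ _ p <= phi_mx _ _ G)%MS.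
  rewrite submxE; split=> [h|/eqP h].
    have := congr1 (phi_mx _ _) h; rewrite /phi_mx map_mxM hC -scalemxAr map_mx0 => /eqP.
    by rewrite scaler_eq0 (negbTE q0F).
  by apply: inj; rewrite /phi_mx map_mxM hC -scalemxAr h scaler0 map_mx0.
exists C => p; rewrite key; split.
  by move=> /hG[w ->]; rewrite /phi_mx map_mxM submxMl.
move=> /submxP[w hw]; have [c [w' [c0 hw']]] := frac_clear_mx w.
apply: (sat c) => //; apply/hG; exists w'; apply: inj.
by rewrite /phi_mx map_mxM hw' -scalemxAl -hw map_mxZ.
Qed.

(** * The Fitting radical of a Phi_r-algebra *)

Section FitStructure.
Variables (k : fieldType) (A : lieAlg k).
Hypothesis hA : metabelian A.
Hypothesis P2 : forall x y : A, x ⋆ y ⋆ x = 0 -> x ⋆ y ⋆ y = 0 -> x ⋆ y = 0.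
Hypothesis P3 : forall x y z : A, x != 0 -> x ⋆ y = 0 -> x ⋆ z = 0 -> y ⋆ z = 0.

Lemma fit_comm (u v : A) : Fit_el u -> Fit_el v -> u ⋆ v = 0.
Proof.
by move=> hu hv; apply: P2; rewrite ?hu // (brC u v) brNl hv oppr0.
Qed.

Lemma fit_br (x y : A) : Fit_el (x ⋆ y).
Proof. by move=> z; apply: hA. Qed.

(** The cross terms are products of two Fitting elements, which vanish by [fit_comm]. *)
Lemma fitD (u v : A) : Fit_el u -> Fit_el v -> Fit_el (u + v).
Proof.
move=> hu hv y; rewrite !lie_brDl !lie_brDr hu hv addr0 add0r.
rewrite (fit_comm (fit_br u y) hv) (fit_comm (fit_br v y) hu); exact: addr0.
Qed.

Lemma fitZ c (u : A) : Fit_el u -> Fit_el (c *: u).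
Proof. by move=> hu y; rewrite lie_brZl lie_brZl lie_brZr hu !scaler0. Qed.

Lemma fitN (u : A) : Fit_el u -> Fit_el (- u).
Proof. by rewrite -scaleN1r; apply: fitZ. Qed.

Lemma fitB (u v : A) : Fit_el u -> Fit_el v -> Fit_el (u - v).
Proof. by move=> hu hv; apply: fitD => //; apply: fitN. Qed.

Lemma fit_sum (I : Type) (s : seq I) (P : pred I) (G : I -> A) :
  (forall i, P i -> Fit_el (G i)) -> Fit_el (\sum_(i <- s | P i) G i).
Proof. by move=> h; apply: big_ind => //; [exact: fit_el0|exact: fitD]. Qed.

Lemma fit_ccder (u : A) : Fit_el u -> ccder u.
Proof. by move=> hu x y; apply: fit_comm => //; apply: fit_br. Qed.

Lemma fit_derived (u : A) : derived u -> Fit_el u.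
Proof. by move=> [m [xs [ys ->]]]; apply: fit_sum => i _; apply: fit_br. Qed.

Lemma fit_act n (b : 'I_n -> A) (u : A) f : Fit_el u -> Fit_el (act u b f).
Proof.
move=> hu; apply: fit_sum => m _; apply: fitZ.
rewrite /act_mono; elim: (enum 'I_n) u hu => //= i s IH u hu; apply: IH.
by case: (m i) => //= j; apply: fit_br.
Qed.

(** Starting from the empty tuple, an independent tuple that does not span modulo the Fitting
    radical is extended by one element; Phi4 stops this before length $r+1$. *)
Lemma phi_basis r : (forall x : 'I_r.+1 -> A, ~ phi x) ->
  exists n (x : 'I_n -> A), [/\ (n <= r)%N, phi x &
    forall z, exists al : 'I_n -> k, Fit_el (z - \sum_i al i *: x i)].
Proof.
move=> P4; apply: NNPP => no.
suff ex n : (n <= r.+1)%N -> exists x : 'I_n -> A, phi x.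
  by have [x /P4] := ex _ (leqnn _).
elim: n => [_|n IH nr]; first by exists (fun=> 0) => al [[]].
have [x hx] := IH (ltnW nr).
have [z hz] : exists z, ~ exists al : 'I_n -> k, Fit_el (z - \sum_i al i *: x i).
  by apply: not_all_ex_not => h; apply: no; exists n, x.
exists (fun i => if unlift ord_max i is Some j then x j else z) => al [i ali].
have wE (j : 'I_n) : unlift ord_max (widen_ord (leqnSn n) j) = Some j.
  have -> : widen_ord (leqnSn n) j = lift ord_max j.
    by apply/val_inj; rewrite /= /bump leqNgt ltn_ord.
  exact: liftK.
rewrite big_ord_recr /= unlift_none.
under eq_bigr => j _ do rewrite wE.
have [a0|a0] := eqVneq (al ord_max) 0.
  rewrite a0 scale0r addr0; apply: hx.
  have [j ij|im] := unliftP ord_max i; last by rewrite im a0 eqxx in ali.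
  exists j; rewrite (_ : widen_ord _ j = i) // ij.
  by apply/val_inj; rewrite /= /bump leqNgt ltn_ord.
(* A nonzero last coefficient can be divided out, which would express [z] modulo the Fitting
   radical. *)
move=> /(fitZ (al ord_max)^-1) h; apply: hz.
exists (fun j => - ((al ord_max)^-1 * al (widen_ord (leqnSn n) j))).
rewrite (_ : z - _ = (al ord_max)^-1 *: (\sum_(i0 < n) al (widen_ord (leqnSn n) i0) *: x i0 + al ord_max *: z)) //.
rewrite scalerDr scalerA mulVf // scale1r addrC; congr (_ + _).
rewrite scaler_sumr -sumrN; apply: eq_bigr => j _.
by rewrite scaleNr opprK scalerA.
Qed.

Variables (n : nat) (x : 'I_n -> A).
Hypothesis hx : phi x.
Hypothesis hspan : forall z, exists al : 'I_n -> k, Fit_el (z - \sum_i al i *: x i).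
Hypothesis P5 : forall f : {mpoly k[n]}, f != 0 -> forall z1 z2 : A,
  act (z1 ⋆ z2) x f = 0 -> (0 < n)%N -> z1 ⋆ z2 = 0.

Definition xi z : 'I_n -> k := proj1_sig (constructive_indefinite_description _ (hspan z)).

Definition fp z : A := z - \sum_i xi z i *: x i.

Lemma fit_fp z : Fit_el (fp z).
Proof. by rewrite /fp /xi; case: constructive_indefinite_description. Qed.

Lemma fpE z : z = \sum_i xi z i *: x i + fp z.
Proof. by rewrite addrC subrK. Qed.

Lemma xi_uniq z al : Fit_el (z - \sum_i al i *: x i) -> xi z =1 al.
Proof.
move=> h i; apply/eqP; rewrite -subr_eq0; apply: contraT => ne.
case: (hx (alpha := fun i => xi z i - al i)); first by exists i.
have := fitB h (fit_fp z); rewrite /fp opprB addrC addrA subrK.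
by rewrite -sumrB; under eq_bigr => j _ do rewrite -scalerBl.
Qed.

Lemma xiP c y z i : xi (c *: y + z) i = c * xi y i + xi z i.
Proof.
apply: (xi_uniq (al := fun i => c * xi y i + xi z i)); rewrite (_ : _ - _ = c *: fp y + fp z).
  by apply: fitD; [apply: fitZ|]; apply: fit_fp.
rewrite /fp scalerBr addrACA -opprD; congr (_ - _).
rewrite scaler_sumr -big_split; apply: eq_bigr => j _ /=.
by rewrite scalerA scalerDl.
Qed.

Lemma xi_fit u i : Fit_el u -> xi u i = 0.
Proof.
by move=> hu; apply: (xi_uniq (al := fun=> 0)); rewrite big1 ?subr0 // => j _; rewrite scale0r.
Qed.

Lemma fpP c y z : fp (c *: y + z) = c *: fp y + fp z.
Proof.
rewrite /fp scalerBr addrACA -opprD; congr (_ - _).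
rewrite scaler_sumr -big_split; apply: eq_bigr => j _ /=.
by rewrite xiP scalerDl scalerA.
Qed.

Lemma fp_fit u : Fit_el u -> fp u = u.
Proof.
by move=> hu; rewrite /fp big1 ?subr0 // => j _; rewrite xi_fit // scale0r.
Qed.

Definition ell z : {mpoly k[n]} := \sum_i xi z i *: 'X_i.

Lemma ellP c y z : ell (c *: y + z) = c *: ell y + ell z.
Proof.
rewrite /ell scaler_sumr -big_split; apply: eq_bigr => j _ /=.
by rewrite xiP scalerDl scalerA.
Qed.

Lemma ell_fit u : Fit_el u -> ell u = 0.
Proof. by move=> hu; apply: big1 => i _; rewrite xi_fit // scale0r. Qed.

Lemma br_ell u z : Fit_el u -> u ⋆ z = act u x (ell z).
Proof.
move=> hu; rewrite {1}(fpE z) lie_brDr (fit_comm hu (fit_fp z)) addr0.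
rewrite act_sumr br_sumr; apply: eq_bigr => i _.
by rewrite actZr actXU ?lie_brZr //; apply: fit_ccder.
Qed.

Lemma br_decomp y z : y ⋆ z =
  \sum_i \sum_j (xi y i * xi z j) *: (x i ⋆ x j)
  + (act (fp y) x (ell z) - act (fp z) x (ell y)).
Proof.
rewrite -(br_ell _ (fit_fp y)) -(br_ell _ (fit_fp z)).
have E : (\sum_i xi y i *: x i) ⋆ fp z = - (fp z ⋆ y).
  by rewrite brC [in RHS](fpE y) lie_brDr (fit_comm (fit_fp z) (fit_fp y)) addr0.
have Y : y ⋆ z = (\sum_i xi y i *: x i) ⋆ z + fp y ⋆ z by rewrite -lie_brDl -fpE.
have Z : (\sum_i xi y i *: x i) ⋆ z = (\sum_i xi y i *: x i) ⋆ (\sum_i xi z i *: x i)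
    + (\sum_i xi y i *: x i) ⋆ fp z by rewrite -lie_brDr -fpE.
rewrite Y Z E -addrA [- _ + _]addrC; congr (_ + _).
rewrite br_suml; apply: eq_bigr => i _; rewrite br_sumr; apply: eq_bigr => j _.
by rewrite lie_brZl lie_brZr scalerA.
Qed.

(** Phi5 speaks of products only, so it is applied to the products of [u] with the [x i]. If these
    vanish and [u] is nonzero, Phi3 makes [A] abelian, against [phi x]. For $n=0$ the polynomial is
    a nonzero constant. *)
Lemma fit_torsion u f : Fit_el u -> f != 0 -> act u x f = 0 -> u = 0.
Proof.
move=> hu f0 h; have [n0|n0] := posnP n.
  have fE := nvar0_mpolyC_eq f n0; move: h f0; rewrite fE actC mpolyC_eq0 => /eqP.
  by rewrite scaler_eq0 => /orP[->|/eqP].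
have ux i : u ⋆ x i = 0.
  by apply: (P5 f0) => //; rewrite act_brl ?h ?br0l //; apply: fit_ccder.
apply/eqP; apply: contraT => u0.
have uz z : u ⋆ z = 0.
  rewrite br_ell // act_sumr big1 // => i _.
  by rewrite actZr actXU ?ux ?scaler0 //; apply: fit_ccder.
case: (hx (alpha := fun=> 1)); first by exists (Ordinal n0); apply: oner_neq0.
by move=> y; rewrite (P3 u0 (uz _) (uz y)) br0l.
Qed.

(** The Fitting components of the Lie generators and the products of the [x i] suffice: induction on
    terms, with [br_decomp] for the bracket. *)
Lemma fit_generators : fin_gen A -> exists l (y : 'I_l -> A), (forall j, Fit_el (y j)) /\
  forall u, Fit_el u -> exists p : 'rV[{mpoly k[n]}]_l, u = \sum_j act (y j) x (p 0 j).
Proof.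
move=> [mm [g hg]]; pose J := ('I_mm + 'I_n * 'I_n)%type.
pose y (j : J) := match j with inl i => fp (g i) | inr (i, j) => x i ⋆ x j end.
have fy j : Fit_el (y j) by case: j => [i|[i j]]; [apply: fit_fp|apply: fit_br].
pose S u := exists p : J -> {mpoly k[n]}, u = \sum_j act (y j) x (p j).
have SP c u v : S u -> S v -> S (c *: u + v).
  move=> [p ->] [q ->]; exists (fun j => c *: p j + q j).
  rewrite scaler_sumr -big_split; apply: eq_bigr => j _ /=.
  by rewrite actDr actZr.
have S0 : S 0 by exists (fun=> 0); rewrite big1 // => j _; rewrite act0r.
have SD u v : S u -> S v -> S (u + v) by rewrite -{2}[u]scale1r; apply: SP.
have SZ c u : S u -> S (c *: u) by rewrite -[c *: u]addr0 => hu; apply: SP.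
have SN u : S u -> S (- u) by rewrite -scaleN1r; apply: SZ.
have SA u f : S u -> S (act u x f).
  move=> [p ->]; exists (fun j => p j * f); rewrite act_suml; apply: eq_bigr => j _.
  by rewrite actM //; apply: fit_ccder.
have Sy j : S (y j).
  exists (fun i => (i == j)%:R); rewrite (bigD1 j) //= eqxx act1 big1 ?addr0 // => i /negbTE ->.
  exact: act0r.
have Sg (t : lterm k 'I_mm) : S (fp (teval g t)).
  elim: t => [i||t1 h1 t2 h2|t h|t1 h1 t2 h2|c t h] /=.
  - exact: (Sy (inl i)).
  - by rewrite fp_fit //; apply: fit_el0.
  - by rewrite -[teval g t1]scale1r fpP; apply: SP.
  - rewrite -[- _]addr0 -scaleN1r fpP (fp_fit (@fit_el0 _ _)) addr0; exact: SZ.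
  - rewrite fp_fit; last exact: fit_br.
    rewrite br_decomp; apply: (SD); last by apply: (SD); [|apply: (SN)]; apply: (SA).
    apply: big_ind => // i _; apply: big_ind => // j _; apply: (SZ); exact: (Sy (inr (i, j))).
  - rewrite -[c *: _]addr0 fpP (fp_fit (@fit_el0 _ _)) addr0; exact: SZ.
exists #|{: J}|, (fun i => y (enum_val i)); split=> [j|u hu]; first exact: fy.
have [t ht] := hg u; have := Sg t; rewrite ht fp_fit // => -[p ->].
exists (\row_i p (enum_val i)).
rewrite (reindex _ (onW_bij _ (@enum_val_bij J))) /=.
by apply: eq_bigr => j _; rewrite mxE.
Qed.

(** * A module map onto a multiple of $\mathrm{Fit}(F_n)$ and the resulting embedding *)

Section Retraction.
Variables (Fn : lieAlg k) (an : 'I_n -> Fn).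
Variable mun : Fn -> {ffun 'I_n -> {mpoly k[n]}}.
Hypothesis Hn : fox_derivation an mun.
Hypothesis P7 : (0 < n)%N -> forall (m l : nat)
  (f : 'I_m -> 'I_l -> {mpoly k[n]}) (c : 'I_m -> lterm k 'I_n),
  (forall i, derived (teval an (c i))) ->
  ~ solvable_loc an f (fun i => teval an (c i)) ->
  forall y : 'I_l -> A, (forall j i, y j ⋆ x i ⋆ y j = 0) ->
  exists i, \sum_j act (y j) x (f i j) - teval x (c i) != 0.
Variables (l : nat) (y : 'I_l -> A).
Hypothesis fy : forall j, Fit_el (y j).
Hypothesis gen : forall u, Fit_el u ->
  exists p : 'rV[{mpoly k[n]}]_l, u = \sum_j act (y j) x (p 0 j).

Definition ev (p : 'rV[{mpoly k[n]}]_l) : A := \sum_j act (y j) x (p 0 j).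

Lemma evP f p q : ev (f *: p + q) = act (ev p) x f + ev q.
Proof.
rewrite /ev act_suml -big_split; apply: eq_bigr => j _ /=.
by rewrite !mxE actDr mulrC actM //; apply: fit_ccder.
Qed.

Lemma ev0 : ev 0 = 0.
Proof. by rewrite /ev big1 // => j _; rewrite mxE act0r. Qed.

Lemma evZ f p : ev (f *: p) = act (ev p) x f.
Proof. by rewrite -[f *: p]addr0 evP ev0 addr0. Qed.

Lemma evD p q : ev (p + q) = ev p + ev q.
Proof. by rewrite -{1}[p]scale1r evP act1. Qed.

Lemma ev_submod : submod (fun p => ev p = 0).
Proof.
split; first exact: ev0.
  by move=> p q hp hq; rewrite evD hp hq addr0.
by move=> f p hp; rewrite evZ hp act0l.
Qed.

Lemma ev_fgen : fgen (fun p => ev p = 0).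
Proof. exact: noetherian_rows (@noetherian_mpoly k n) _ ev_submod. Qed.

Lemma wbr_eps i j : wbr (eps i 1) (eps j 1) = kos i j 1 :> {ffun 'I_n -> {mpoly k[n]}}.
Proof. by apply/ffunP => p; rewrite !ffunE !bd_eps !mul1r !mulr1. Qed.

Definition dot (d : 'I_l -> {ffun 'I_n -> {mpoly k[n]}}) (p : 'rV[{mpoly k[n]}]_l) :=
  \sum_j modact (d j) (p 0 j).

Lemma dotP d f p q : dot d (f *: p + q) = modact (dot d p) f + dot d q.
Proof.
apply/ffunP => i; rewrite !ffunE !sum_ffunE mulr_suml -big_split; apply: eq_bigr => j _ /=.
by rewrite !ffunE !mxE mulrDr mulrCA mulrC.
Qed.

Lemma dot0 d : dot d 0 = 0.
Proof.
by rewrite /dot big1 // => j _; apply/ffunP => i; rewrite !ffunE mxE mulr0.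
Qed.

Lemma dotD d p q : dot d (p + q) = dot d p + dot d q.
Proof.
rewrite -{1}[p]scale1r dotP; congr (_ + _); by apply/ffunP => i; rewrite !ffunE mulr1.
Qed.

Lemma dotZ d f p : dot d (f *: p) = modact (dot d p) f.
Proof. by rewrite -[f *: p]addr0 dotP dot0 addr0. Qed.

Lemma bd_dot d p : (forall j, bd (d j) = 0) -> bd (dot d p) = 0.
Proof. by move=> hd; rewrite bd_sum big1 // => j _; rewrite bd_modact hd mul0r. Qed.

(* Phi7 applied to a finite presentation of Fit(A) over Fit(F_n): a solution in
   the localisation is, up to the denominator [s], a retraction onto Fit(F_n). *)
Lemma fit_retraction : exists (s : {mpoly k[n]}) (d : 'I_l -> {ffun 'I_n -> {mpoly k[n]}}),
  [/\ s@_0%MM = 1, forall j, bd (d j) = 0, forall p, ev p = 0 -> dot d p = 0 &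
      forall i j p, ev p = x i ⋆ x j -> dot d p = kos i j s].
Proof.
have [n0|n0] := posnP n.
  have Z (d e : {ffun 'I_n -> {mpoly k[n]}}) : d = e.
    by apply/ffunP => -[i hi]; exfalso; rewrite n0 in hi.
  exists 1, (fun=> 0); split=> [|j|p _|i j p _]; try exact: Z.
    by rewrite mcoeff1 eqxx.
  by rewrite bd0.
have [g [G hG]] := fgen_matrix ev_submod ev_fgen.
have cof (ij : 'I_n * 'I_n) := gen (fit_br (x ij.1) (x ij.2)).
pose P ij := proj1_sig (constructive_indefinite_description _ (cof ij)).
have hP ij : ev (P ij) = x ij.1 ⋆ x ij.2.
  by rewrite /P; case: constructive_indefinite_description.
(* The system has two families: the defining relations of the module, with right side zero, and the
   coordinates of each product of [x i] and [x j], with right side the product of the corresponding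
   generators. *)
pose I := ('I_g + 'I_n * 'I_n)%type.
pose fI (i : I) : 'rV_l := match i with inl i => row i G | inr ij => P ij end.
pose cI (i : I) : lterm k 'I_n :=
  match i with inl _ => TZero _ _ | inr ij => TBr (TVar k ij.1) (TVar k ij.2) end.
have evI i : ev (fI i) = teval x (cI i).
  case: i => [i|ij] /=; last exact: hP.
  by apply/hG; exists (delta_mx 0 i); rewrite rowE.
have dI i : derived (teval an (cI i)).
  by case: i => [i|ij] /=; [apply: derived0|apply: derived_br].
have [s [y' [s0 [dy' sol]]]] : solvable_loc an (fun (i : 'I_#|{: I}|) j => fI (enum_val i) 0 j)
    (fun i => teval an (cI (enum_val i))).
  (* The generators [y] solve the system in [A], so Phi7 excludes its being unsolvable in the
     localisation. *)
  apply: NNPP => /(P7 n0 (fun i => dI _)) /(_ y) [j i|i]; first exact: fy.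
  by rewrite -evI subrr eqxx.
have sol' i : dot (fun j => mun (y' j)) (fI i) = modact (mun (teval an (cI i))) s.
  have [u [u0]] := sol (enum_rank i); rewrite enum_rankK => /(congr1 mun).
  (* A nonzero constant term makes [u] nonzero, so it cancels in $R_n^n$. *)
  have nu : u != 0 by apply: contraNneq u0 => ->; rewrite mcoeff0.
  have dsum : derived (\sum_j act (y' j) an (fI i 0 j)).
    by apply: derived_sum => j _; apply: derived_act.
  rewrite (fox_act_gen Hn) ?(fox0 Hn).
    move/modact_eq0 => /(_ nu); rewrite (foxD Hn) (foxN Hn) (fox_sum Hn) (fox_act_gen Hn) //.
    move/eqP; rewrite subr_eq0 => /eqP <-; apply: eq_bigr => j _.
    by rewrite (fox_act_gen Hn).
  rewrite -scaleN1r; apply: derivedD => //; apply: derivedZ; exact: derived_act.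
(* Rescaling gives the denominator constant term one, so that $s-1$ lies in $\Delta$. *)
pose c := (s@_0%MM)^-1; exists (c *: s), (fun j => c *: mun (y' j)).
have dotc p : dot (fun j => c *: mun (y' j)) p = c *: dot (fun j => mun (y' j)) p.
  rewrite scaler_sumr; apply: eq_bigr => j _; apply/ffunP => i.
  by rewrite !ffunE scalerAl.
have ker p : ev p = 0 -> dot (fun j => mun (y' j)) p = 0.
  move=> /hG[w ->]; rewrite mulmx_sum_row.
  rewrite (big_morph (dot (fun j => mun (y' j))) (dotD _) (dot0 _)).
  rewrite big1 // => i _; rewrite dotZ (sol' (inl i)) /= (fox0 Hn).
  by apply/ffunP => q; rewrite !ffunE !mul0r.
split.
- by rewrite mcoeffZ mulVf.
- by move=> j; rewrite bdZ (proj1 (fox_derivedP Hn _) (dy' j)) scaler0.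
- by move=> p hp; rewrite dotc ker ?scaler0.
move=> i j p hp; rewrite dotc kosZ; congr (_ *: _).
rewrite -[p](subrK (P (i, j))) dotD ker ?add0r.
  rewrite (sol' (inr (i, j))) /= (foxB Hn) !(fox_gen Hn) wbr_eps.
  by rewrite modact_kos mul1r.
by rewrite -scaleN1r evD evZ hp hP -mpolyC1 -mpolyCN actC scaleN1r subrr.
Qed.

(** Torsion-freeness saturates the kernel of [ev]; thus [C] induces an embedding of
    $\mathrm{Fit}(A)$ in $R_n^l$. *)
Lemma ev_kernel : exists C : 'M[{mpoly k[n]}]_l, forall p, ev p = 0 <-> p *m C = 0.
Proof.
apply: saturated_kernel ev_submod ev_fgen _ => q p q0; rewrite evZ.
by apply: fit_torsion q0; apply: fit_sum => j _; apply: fit_act.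
Qed.

Lemma bd_division (f : {mpoly k[n]}) : bd (linext (@division k n) f) = f - (f@_0%MM)%:MP.
Proof.
move: f; apply: mpoly_lin_eq => [c f g|c f g|m].
- by rewrite linextD linextZ bdD bdZ.
- rewrite mcoeffD mcoeffZ mpolyCD opprD addrACA mpolyCM mul_mpolyC.
  by rewrite -scalerBr.
rewrite linextX /division mcoeffX; case hm: (lead m) => [i|].
  have [mi _] := lead_some hm.
  rewrite bd_eps -mpolyXD addmC addU_sub // (_ : (m == 0%MM) = false) ?subr0 //.
  by apply/eqP => m0; rewrite m0 mnm0E in mi.
by rewrite (lead_none hm) eqxx mpolyX0 bd0 subrr.
Qed.

(** The action [sc] is abstract so that the lemma serves both for [Pi], with values in $R_n^n$, and
    for [io] after [psi], with values in rows. *)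
Lemma fit_linear_br (V : zmodType) (sc : V -> {mpoly k[n]} -> V) (Q : A -> V) :
  (forall v, sc v 1 = v) ->
  (forall f u v, Fit_el u -> Fit_el v -> Q (act u x f + v) = sc (Q u) f + Q v) ->
  forall z t, Q (z ⋆ t) = \sum_i \sum_j sc (Q (x i ⋆ x j)) (xi z i * xi t j)%:MP
    + (sc (Q (fp z)) (ell t) + sc (Q (fp t)) (- ell z)).
Proof.
move=> sc1 QA z t.
have Q0 : Q 0 = 0.
  have := QA 1 0 0 (@fit_el0 _ A) (@fit_el0 _ A).
  by rewrite act1 addr0 sc1 => /eqP; rewrite -subr_eq0 opprD addrA subrr sub0r oppr_eq0 => /eqP.
have QD u v : Fit_el u -> Fit_el v -> Q (u + v) = Q u + Q v.
  by move=> hu hv; have := QA 1 u v hu hv; rewrite act1 sc1.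
have QS (I : finType) (G : I -> A) : (forall i, Fit_el (G i)) ->
    Q (\sum_i G i) = \sum_i Q (G i) /\ Fit_el (\sum_i G i).
  move=> hG; apply: (big_ind2 (fun u v => Q u = v /\ Fit_el u)).
  - by split=> //; apply: fit_el0.
  - move=> u1 v1 u2 v2 [e1 f1] [e2 f2]; split; first by rewrite QD // e1 e2.
    exact: fitD.
  - by [].
have QC u f : Fit_el u -> Q (act u x f) = sc (Q u) f.
  by move=> hu; have := QA f u 0 hu (@fit_el0 _ A); rewrite !addr0 Q0 addr0.
have fx i j c : Fit_el (c *: (x i ⋆ x j)) by apply/fitZ/fit_br.
have fxs i : Fit_el (\sum_j (xi z i * xi t j) *: (x i ⋆ x j)) by apply: fit_sum.
have fa u f : Fit_el u -> Fit_el (act u x f) by apply: fit_act.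
have [QSS fS] := QS _ _ fxs.
have f1 : Fit_el (act (fp z) x (ell t)) by apply: fa; apply: fit_fp.
have f2 : Fit_el (act (fp t) x (- ell z)) by apply: fa; apply: fit_fp.
rewrite br_decomp -actNr (QD _ _ fS (fitD f1 f2)) (QD _ _ f1 f2).
rewrite QSS (QC _ _ (fit_fp z)) (QC _ _ (fit_fp t)).
congr (_ + _); apply: eq_bigr => i _; rewrite (QS _ _ (fun j => fx i j _)).1.
by apply: eq_bigr => j _; rewrite -(actC x) (QC _ _ (fit_br _ _)).
Qed.

(* [D z] is the vector of Fox derivatives of the component of [z] in F_n, and
   [M z] its component in R_n^l. *)
Lemma fit_embedding : exists (D : A -> {ffun 'I_n -> {mpoly k[n]}}) (M : A -> 'rV[{mpoly k[n]}]_l),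
  [/\ forall c z t, D (c *: z + t) = c *: D z + D t /\ M (c *: z + t) = c%:MP *: M z + M t,
      forall z t, D (z ⋆ t) = wbr (D z) (D t) /\ M (z ⋆ t) = ell t *: M z - ell z *: M t,
      forall z, bd (D z) = ell z &
      forall z, D z = 0 -> M z = 0 -> z = 0].
Proof.
have [s [d [s0 hd ker dotx]]] := fit_retraction.
have [C hC] := ev_kernel.
have Cs u : exists p, Fit_el u -> u = ev p.
  by have [/gen[p hp]|hu] := classic (Fit_el u); [exists p|exists 0].
pose co u := proj1_sig (constructive_indefinite_description _ (Cs u)).
have coE u : Fit_el u -> ev (co u) = u.
  by rewrite /co; case: constructive_indefinite_description => p hp /= /hp.
have evB p q : ev p = ev q -> ev (p - q) = 0.
  by move=> h; rewrite -scaleN1r evD evZ h -mpolyC1 -mpolyCN actC scaleN1r subrr.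
have fit_ev p : Fit_el (ev p) by apply: fit_sum => j _; apply: fit_act.
(* Both maps are independent of the coordinates picked by [co], since [dot d] and multiplication by
   [C] vanish on the kernel of [ev]. *)
pose Pi u := dot d (co u).
pose io u := co u *m C.
have PiE p : Pi (ev p) = dot d p.
  rewrite /Pi -[co _](subrK p) dotD ker ?add0r //.
  by apply: evB; rewrite coE.
have ioE p : io (ev p) = p *m C.
  rewrite /io -[co _](subrK p) mulmxDl (proj1 (hC _)) ?add0r //.
  by apply: evB; rewrite coE.
have PiA f u v : Fit_el u -> Fit_el v -> Pi (act u x f + v) = modact (Pi u) f + Pi v.
  by move=> /coE {1}<- /coE {1}<-; rewrite -evP PiE dotP.
have ioA f u v : Fit_el u -> Fit_el v -> io (act u x f + v) = f *: io u + io v.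
  by move=> /coE {1}<- /coE {1}<-; rewrite -evP ioE mulmxDl -scalemxAl.
have Pi0 : Pi 0 = 0 by rewrite -ev0 PiE dot0.
have io0 : io 0 = 0 by rewrite -ev0 ioE mul0mx.
have bPi u : bd (Pi u) = 0 by apply: bd_dot.
have Pix i j : Pi (x i ⋆ x j) = kos i j s by apply: dotx; rewrite coE //; apply: fit_br.
have modC (e : {ffun 'I_n -> {mpoly k[n]}}) (c : k) : modact e c%:MP = c *: e.
  by apply/ffunP => i; rewrite !ffunE mulrC mul_mpolyC.
have PiP c u v : Fit_el u -> Fit_el v -> Pi (c *: u + v) = c *: Pi u + Pi v.
  by move=> hu hv; rewrite -(actC x u c) PiA // modC.
have fh e : bd e = 0 -> Fit_el (hsyz x e).
  by move=> he; apply: fit_derived; apply: derived_hsyz.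
(* [hsyz x] carries the cycle [Pi u] back to [A] along $a_i\mapsto x_i$; on a product of two [x i]
   this gives multiplication by [s], so [psi] vanishes there. *)
pose psi u := act u x s - hsyz x (Pi u).
have fpsi u : Fit_el u -> Fit_el (psi u).
  by move=> hu; apply: fitB; [apply: fit_act|apply: fh].
have psiA f u v : Fit_el u -> Fit_el v -> psi (act u x f + v) = act (psi u) x f + psi v.
  move=> hu hv; rewrite /psi PiA // hsyzD hsyz_modact // !actDl actNl opprD addrACA.
  by rewrite (actAC hA) //; apply: fit_ccder.
have psix i j : psi (x i ⋆ x j) = 0 by rewrite /psi Pix hsyz_kos // subrr.
pose pp := linext (@division k n) s.
have bpp : bd pp = s - 1 by rewrite bd_division s0 mpolyC1.
pose lin z : {ffun 'I_n -> {mpoly k[n]}} := \sum_i xi z i *: eps i s.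
(* The vector [eps i s] minus [pp] times $x_i$ is the Fox vector of $a_i+\sum_l [a_i,a_l]p_l$, where
   [pp] has entries $p_l$ and $s=1+\sum_l p_l x_l$. *)
pose D z := lin z - modact pp (ell z) + Pi (fp z).
pose M z := io (psi (fp z)).
have linP c z t : lin (c *: z + t) = c *: lin z + lin t.
  rewrite scaler_sumr -big_split; apply: eq_bigr => i _ /=.
  by rewrite xiP scalerDl scalerA.
have bdlin z : bd (lin z) = ell z * s.
  rewrite bd_sum mulr_suml; apply: eq_bigr => i _.
  by rewrite bdZ bd_eps -scalerAl mulrC.
have bdD_ z : bd (D z) = ell z.
  rewrite !bdD bdN bd_modact bPi bdlin bpp addr0 mulrBl mul1r mulrC opprB addrCA subrr.
  exact: addr0.
have sc1 (v : 'rV[{mpoly k[n]}]_l) : 1 *: v = v by apply: scale1r.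
have m1 (v : {ffun 'I_n -> {mpoly k[n]}}) : modact v 1 = v.
  by apply/ffunP => i; rewrite ffunE mulr1.
have lin0 z : Fit_el z -> lin z = 0.
  by move=> hz; apply: big1 => i _; rewrite xi_fit // scale0r.
exists D, M; split=> //.
- move=> c z t; split.
    rewrite /D linP ellP fpP PiP; try exact: fit_fp.
    apply/ffunP => i; rewrite !ffunE mulrDr -scalerAr !scalerDr scalerN opprD.
    by rewrite [X in X + _ = _]addrACA [LHS]addrACA.
  rewrite /M fpP -(actC x) psiA; try exact: fit_fp.
  by rewrite ioA //; apply/fpsi/fit_fp.
- move=> z t; split.
    rewrite {1}/D lin0 ?ell_fit ?fp_fit; try exact: fit_br.
    rewrite (_ : modact pp 0 = 0) ?subr0 ?add0r; last first.
      by apply/ffunP => i; rewrite !ffunE mulr0.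
    rewrite (fit_linear_br (sc := fun v f => modact v f) m1 PiA).
    rewrite /wbr !bdD_ /D.
    rewrite (eq_bigr (fun i => \sum_j (xi z i * xi t j) *: kos i j s)); last first.
      by move=> i _; apply: eq_bigr => j _; rewrite Pix modC.
    have -> : \sum_i \sum_j (xi z i * xi t j) *: kos i j s =
        modact (lin z) (ell t) - modact (lin t) (ell z).
      apply/ffunP => p; rewrite !ffunE !sum_ffunE /ell !mulr_suml.
      under [X in X - _]eq_bigr => i _ do rewrite mulr_sumr.
      under [X in _ - X]eq_bigr => i _ do rewrite mulr_sumr.
      rewrite [X in _ - X]exchange_big -sumrB; apply: eq_bigr => i _.
      rewrite sum_ffunE -sumrB; apply: eq_bigr => j _.
      rewrite !ffunE -!scalerAl -!scalerAr !scalerA (mulrC (xi t j)) scalerBr.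
      by rewrite !mulrA ![_ * _ * s]mulrAC.
    apply/ffunP => p; rewrite !ffunE !mulrDl !mulNr mulrN [pp p * ell t * ell z]mulrAC.
    rewrite [X in _ = X - _]addrAC [X in _ = _ - X]addrAC opprB subrKA opprD.
    by rewrite addrACA.
  rewrite /M fp_fit; last exact: fit_br.
  rewrite (fit_linear_br (Q := fun u => io (psi u)) (sc := fun v f => f *: v) sc1).
    rewrite big1 => [|i _]; last by rewrite big1 // => j _; rewrite psix io0 scaler0.
    by rewrite add0r scaleNr.
  by move=> f u v hu hv; rewrite psiA // ioA //; apply: fpsi.
(* From [D z = 0] follows [ell z = 0], so [z] is a Fitting element with [Pi z = 0]. Then [psi z] is
   [s] acting on [z], and injectivity of [io] and torsion-freeness give [z = 0]. *)
- move=> z hD hM.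
  have e0 : ell z = 0 by rewrite -bdD_ hD bd0.
  have x0 i : xi z i = 0.
    have := congr1 (mcoeff U_(i)) e0; rewrite mcoeff0 raddf_sum /= (bigD1 i) //= big1.
      by rewrite mcoeffZ mcoeffXU eqxx mulr1 addr0.
    by move=> j /negbTE ji; rewrite mcoeffZ mcoeffXU ji mulr0.
  have zE : z = fp z.
    by rewrite {1}(fpE z) big1 ?add0r // => i _; rewrite x0 scale0r.
  have hz : Fit_el z by rewrite zE; apply: fit_fp.
  have s00 : s != 0 by apply/eqP => E; move/eqP: s0; rewrite E mcoeff0 eq_sym oner_eq0.
  apply: (fit_torsion hz s00).
  move: hD hM; rewrite /D /M lin0 // e0 (fp_fit hz) (_ : modact pp 0 = 0) ?subr0 ?add0r; last first.
    by apply/ffunP => i; rewrite !ffunE mulr0.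
  rewrite /psi => ->; rewrite hsyz0 subr0 => /hC; rewrite coE //; exact: fit_act.
Qed.

End Retraction.
End FitStructure.

(** * Extension of the rank from $n$ to $r$, and the embedding in $F_{r,s}$ *)

Section Widen.
Variables (k : fieldType) (n r : nat) (hn : (n <= r)%N).
Local Notation w := (widen_ord hn).

Definition wid : {mpoly k[n]} -> {mpoly k[r]} := mmap (@mpolyC r k) (fun i => 'X_(w i)).

HB.instance Definition _ := GRing.RMorphism.copy wid
  (mmap (@mpolyC r k) (fun i => 'X_(w i))).

Lemma widZ c f : wid (c *: f) = c *: wid f.
Proof. by rewrite /wid mmapZ mul_mpolyC. Qed.

Lemma widX i : wid 'X_i = 'X_(w i).
Proof. by rewrite [LHS]mmapX mmap1U. Qed.

Lemma wid_inj : injective wid.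
Proof.
(* The left inverse sends the additional variables to zero. *)
pose v (b : 'I_r) : {mpoly k[n]} := if insub (val b) is Some i then 'X_i else 0.
apply: (@can_inj _ _ _ (mmap (@mpolyC n k) v)) => f.
move: f; apply: mpoly_lin_eq => [c f g|//|m].
  by rewrite [wid _]rmorphD /= widZ rmorphD /= mmapZ mul_mpolyC.
rewrite [wid _]mmapX /mmap1 rmorph_prod mpolyXE_id; apply: eq_bigr => i _ /=.
by rewrite rmorphXn /= mmapX mmap1U /v valK.
Qed.

Definition widv (d : {ffun 'I_n -> {mpoly k[n]}}) : {ffun 'I_r -> {mpoly k[r]}} :=
  \sum_i eps (w i) (wid (d i)).

Lemma widvP c d e : widv (c *: d + e) = c *: widv d + widv e.
Proof.
rewrite scaler_sumr -big_split; apply: eq_bigr => i _ /=.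
by rewrite !ffunE rmorphD /= widZ epsD epsZ.
Qed.

Lemma widvN d : widv (- d) = - widv d.
Proof.
by rewrite -sumrN; apply: eq_bigr => i _; apply/ffunP => j; rewrite !ffunE rmorphN mulrN.
Qed.

Lemma widvD d e : widv (d + e) = widv d + widv e.
Proof. by rewrite -(scale1r d) widvP !scale1r. Qed.

Lemma widv_modact d f : widv (modact d f) = modact (widv d) (wid f).
Proof.
apply/ffunP => j; rewrite !ffunE !sum_ffunE mulr_suml; apply: eq_bigr => i _.
by rewrite !ffunE rmorphM mulrA.
Qed.

Lemma bd_widv d : bd (widv d) = wid (bd d).
Proof.
rewrite bd_sum [bd d]/bd rmorph_sum; apply: eq_bigr => i _ /=.
by rewrite bd_eps rmorphM /= widX.
Qed.

Lemma widv_eq0 d : widv d = 0 -> d = 0.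
Proof.
move=> /ffunP h; apply/ffunP => i; have := h (w i); rewrite sum_ffunE (bigD1 i) //=.
rewrite big1 => [|j ji].
  by rewrite !ffunE eqxx mul1r addr0 -[RHS](rmorph0 wid) => /wid_inj.
rewrite ffunE (_ : (w i == w j) = false) ?mul0r //; apply: contraNF ji => /eqP e.
by apply/eqP/val_inj; have := congr1 val e.
Qed.

Lemma linform_widv d (c : 'I_n -> k) : bd d = \sum_i c i *: 'X_i -> widv d \in @linformb k r.
Proof.
move=> hd; rewrite unfold_in /linform bd_widv hd rmorph_sum /=; apply/eqP.
under [RHS]eq_bigr => b _ do rewrite -mcoeffU_bd bd_widv hd rmorph_sum raddf_sum scaler_suml.
rewrite exchange_big; apply: eq_bigr => i _ /=; rewrite (bigD1 (w i)) //= big1 => [|b bi].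
  by rewrite widZ widX mcoeffZ mcoeffXU eqxx mulr1 addr0.
by rewrite widZ widX mcoeffZ mcoeffXU eq_sym (negbTE bi) mulr0 scale0r.
Qed.

End Widen.

(** The rank [n] of [A] modulo its Fitting radical may be smaller than [r], so the embedding over
    $R_n$ is followed by widening; [bd (D z)] being a linear form makes the widened vector a Fox
    vector in $F_r$. *)
Lemma Phi_embeds (k : fieldType) (F : nat -> lieAlg k) (a : forall n : nat, 'I_n -> F n)
    (hF : forall n : nat, is_free_metabelian (@a n)) (r : nat) (A : lieAlg k) :
  fin_gen A -> Phi_alg a r A -> exists s : nat, embeds_Frs (a r) s A.
Proof.
move=> hfg [hA [P2 [P3 [P4 [P5 [_ P7]]]]]].
have [n [x [hn hx hspan]]] := phi_basis P4.
have P5' (f : {mpoly k[n]}) : f != 0 -> forall z1 z2 : A, act (z1 ⋆ z2) x f = 0 ->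
    (0 < n)%N -> z1 ⋆ z2 = 0.
  move=> f0 z1 z2 h n0; apply/eqP; apply: contraT => z0.
  by case: (P5 n _ f f0 z1 z2 x h z0 hx); rewrite n0.
have [l [y [fy gen]]] := fit_generators hA P2 hx hspan hfg.
have [mun Hn] := magnus_embedding (hF n).
have [mur Hr] := magnus_embedding (hF r).
have P7' : (0 < n)%N -> forall (m l : nat)
    (f : 'I_m -> 'I_l -> {mpoly k[n]}) (c : 'I_m -> lterm k 'I_n),
    (forall i, derived (teval (@a n) (c i))) ->
    ~ solvable_loc (@a n) f (fun i => teval (@a n) (c i)) ->
    forall y : 'I_l -> A, (forall j i, y j ⋆ x i ⋆ y j = 0) ->
    exists i, \sum_j act (y j) x (f i j) - teval x (c i) != 0.
  move=> n0 m l' f c h1 h2 y' h3; apply: (P7 n) => //; by rewrite n0.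
have [D [M [lin br bdD_ inj]]] :=
  fit_embedding hA P2 P3 hx hspan P5' Hn P7' fy gen.
have ex z : exists u, mur u = widv hn (D z).
  by apply: (fox_surj Hr); apply: linform_widv (bdD_ z).
pose gF z := proj1_sig (constructive_indefinite_description _ (ex z)).
have gFE z : mur (gF z) = widv hn (D z).
  by rewrite /gF; case: constructive_indefinite_description.
pose gM z : {ffun 'I_l -> {mpoly k[r]}} := [ffun j => wid hn (M z 0 j)].
have gP c z t : gF (c *: z + t) = c *: gF z + gF t /\ gM (c *: z + t) = c *: gM z + gM t.
  have [hD hM] := lin c z t; split.
    by apply: (fox_inj Hr); rewrite (foxP Hr) !gFE hD widvP.
  by apply/ffunP => j; rewrite !ffunE hM !mxE rmorphD /= mul_mpolyC widZ.
have g0 : gF 0 = 0 /\ gM 0 = 0.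
  by have [] := gP (-1) 0 0; rewrite scaler0 addr0 !scaleN1r !addNr.
have gD z t : gF (z + t) = gF z + gF t /\ gM (z + t) = gM z + gM t.
  by have := gP 1 z t; rewrite !scale1r.
have gZ c z : gF (c *: z) = c *: gF z /\ gM (c *: z) = c *: gM z.
  by have := gP c z 0; rewrite g0.1 g0.2 !addr0.
have gB z t : gF (z ⋆ t) = gF z ⋆ gF t /\
   gM (z ⋆ t) = modact (gM z) (lin_poly (@a r) (gF t)) - modact (gM t) (lin_poly (@a r) (gF z)).
  have [hD hM] := br z t; split.
    apply: (fox_inj Hr); rewrite (foxB Hr) !gFE hD /wbr widvD widvN !widv_modact.
    by rewrite !bd_widv.
  rewrite !(lin_polyE Hr) !gFE !bd_widv !bdD_; apply/ffunP => j.
  by rewrite !ffunE hM !mxE rmorphB !rmorphM /= mulrC [X in _ - X]mulrC.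
exists l, gF, gM; split=> //; split=> //; split=> // z t e1 e2.
apply/eqP; rewrite -subr_eq0; apply/eqP/inj.
  apply: (@widv_eq0 _ _ _ hn); rewrite -gFE -scaleN1r addrC (gP (-1) t z).1 e1.
  by rewrite scaleN1r addNr (fox0 Hr).
apply/rowP => j; apply: (@wid_inj k n r hn); rewrite mxE rmorph0.
have /ffunP/(_ j) : gM (z - t) = 0 by rewrite addrC -scaleN1r (gP (-1) t z).2 e2 scaleN1r addNr.
by rewrite !ffunE.
Qed.

(* F n is the free metabelian Lie algebra of rank n over k with free base a n. *)
Theorem theorem4p1 (k : finFieldType) (F : nat -> lieAlg k)
    (a : forall n : nat, 'I_n -> F n)
    (hF : forall n : nat, is_free_metabelian (a n))
    (r : nat) (hr : (2 <= r)%N)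
    (A : lieAlg k) (hA : metabelian A) (hfg : fin_gen A) :
  (in_ucl (F r) A <-> Phi_alg a r A) /\
  (Phi_alg a r A <-> exists s : nat, embeds_Frs (a r) s A).
Proof.
have to3 : Phi_alg a r A -> exists s : nat, embeds_Frs (a r) s A.
  exact: Phi_embeds.
have to1 : (exists s : nat, embeds_Frs (a r) s A) -> in_ucl (F r) A.
  by move=> [s]; apply: embeds_ucl.
have to2 : in_ucl (F r) A -> Phi_alg a r A by apply: ucl_Phi.
by split; split => [?|?]; auto.
Qed.
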